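(* Let $f:\mathbb{R}^d\to\mathbb{R}$ be SPB with parameters $\mathrm{R}_1,\mathrm{R}_2,m$, let $\sigma>0$ and let $f_\sigma(x)=\mathbb{E}_{u\sim\mathcal{N}(0,I)}[f(x+\sigma u)]$. Then: (i) For all $x,y\in\mathbb{R}^d$, \[|f_\sigma(x)-f_\sigma(y)|\le(\mathfrak{A}+\mathfrak{B}\|x\|^m+\mathfrak{C}\|y-x\|^m)\|x-y\|,\] where $\mathfrak{A}=2^{2m-2}\mathrm{R}_1\sigma^m(m+d)^{m/2}+\mathrm{R}_2$, $\mathfrak{B}=2^{2m-2}\mathrm{R}_1$, $\mathfrak{C}=2^{m-1}\mathrm{R}_1$. In particular, $f_\sigma$ is SPB. (ii) $f_\sigma$ is differentiable and for all $x,y\in\mathbb{R}^d$, \[\|\nabla f_\sigma(x)-\nabla f_\sigma(y)\|\le(\mathcal{A}+\mathcal{B}\|x\|^m+\mathcal{C}\|y-x\|^m)\|x-y\|,\] where $\mathcal{A}=2^{2m-2}\mathrm{R}_1\sigma^{m-1}(m+1+d)^{(m+1)/2}+\sigma^{-1}\mathrm{R}_2\sqrt d$, $\mathcal{B}=2^{2m-2}\sigma^{-1}\mathrm{R}_1\sqrt d$, $\mathcal{C}=2^{m-1}\sigma^{-1}\mathrm{R}_1\sqrt d$. In particular, each partial derivative $\partial f_\sigma/\partial x_i$ is SPB.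
   Context: $\mathcal{N}(0,I)$ is the $d$-dimensional standard Gaussian distribution; $\|\cdot\|$ the Euclidean norm. For a locally Lipschitz $f:\mathbb{R}^d\to\mathbb{R}$, $\partial_C f(x)$ denotes the Clarke subdifferential. $f$ is called SPB (subdifferentially polynomially bounded) with parameters $\mathrm{R}_1\ge0$, $\mathrm{R}_2>0$ and integer $m\ge 0$ (where $\mathrm{R}_1=0$ if and only if $m=0$) if $f$ is locally Lipschitz and $\sup_{\zeta\in\partial_C f(x)}\|\zeta\|\le \mathrm{R}_1\|x\|^m+\mathrm{R}_2$ for all $x\in\mathbb{R}^d$ (convention $0^0=1$). A function is SPB if it is SPB for some such parameters. *)

(* Defs.v *)
From HB Require Import structures.
From mathcomp Require Import all_boot all_order all_algebra.
From mathcomp Require Import all_classical all_reals all_analysis.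

Set Implicit Arguments.
Unset Strict Implicit.
Unset Printing Implicit Defensive.

Import Order.TTheory GRing.Theory Num.Theory.
Import numFieldNormedType.Exports.

Local Open Scope classical_set_scope.
Local Open Scope ring_scope.

Section Defs.
Variable R : realType.

Definition dotv (d : nat) (x y : 'rV[R]_d) : R := \sum_(i < d) x ord0 i * y ord0 i.
Definition enorm (d : nat) (x : 'rV[R]_d) : R := Num.sqrt (\sum_(i < d) x ord0 i ^+ 2).

Definition locally_lipschitz (d : nat) (f : 'rV[R]_d -> R) : Prop :=
  forall x : 'rV[R]_d, exists L : R, exists2 delta : R, 0 < delta &
    forall y z : 'rV[R]_d, enorm (y - x) < delta -> enorm (z - x) < delta ->
      `|f y - f z| <= L * enorm (y - z).

(** Clarke generalized directional derivative
    f°(x; v) = limsup_{y -> x, t -> 0+} (f (y + t v) - f y) / t,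
    written as inf_{delta > 0} sup_{|y - x| < delta, 0 < t < delta}. *)
Definition clarke_dir (d : nat) (f : 'rV[R]_d -> R) (x v : 'rV[R]_d) : \bar R :=
  ereal_inf [set ereal_sup [set r : \bar R | exists (y : 'rV[R]_d) (t : R),
                              [/\ enorm (y - x) < delta, 0 < t < delta &
                                  r = ((f (y + t *: v) - f y) / t)%:E]]
            | delta in [set delta : R | 0 < delta]].

Definition clarke_subdiff (d : nat) (f : 'rV[R]_d -> R) (x : 'rV[R]_d) : set 'rV[R]_d :=
  [set zeta | forall v : 'rV[R]_d, ((dotv zeta v)%:E <= clarke_dir f x v)%E].

(** SPB with parameters R1 >= 0, R2 > 0, m (R1 = 0 iff m = 0);
    note x ^+ 0 = 1, matching the convention 0^0 = 1. *)
Definition SPB_with (d : nat) (f : 'rV[R]_d -> R) (R1 R2 : R) (m : nat) : Prop :=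
  [/\ 0 <= R1, 0 < R2, (R1 = 0 <-> m = 0%N), locally_lipschitz f &
      forall x zeta, clarke_subdiff f x zeta -> enorm zeta <= R1 * enorm x ^+ m + R2].

Definition SPB (d : nat) (f : 'rV[R]_d -> R) : Prop :=
  exists R1 R2 : R, exists m : nat, SPB_with f R1 R2 m.

(** Expectation over u ~ N(0, I_d), as the iterated integral over the d
    independent standard normal coordinates. *)
Fixpoint gauss_exp (d : nat) : ('rV[R]_d -> R) -> R :=
  match d return ('rV[R]_d -> R) -> R with
  | 0%N => fun g => g 0
  | d'.+1 => fun g =>
      Rintegral (@normal_prob R 0 1) [set: R]
        (fun t : R => gauss_exp (fun v : 'rV[R]_d' => g (row_mx (const_mx t : 'rV[R]_1) v)))
  end.

Definition gsmooth (d : nat) (f : 'rV[R]_d -> R) (sigma : R) (x : 'rV[R]_d) : R :=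
  gauss_exp (fun u => f (x + sigma *: u)).

Definition partial (d : nat) (g : 'rV[R]_d -> R) (i : 'I_d) (x : 'rV[R]_d) : R :=
  'D_(delta_mx ord0 i) g x.
Definition grad (d : nat) (g : 'rV[R]_d -> R) (x : 'rV[R]_d) : 'rV[R]_d :=
  \row_i partial g i x.

End Defs.

(* Main.v *)
Require Import Defs.
From HB Require Import structures.
From mathcomp Require Import all_boot all_order all_algebra.
From mathcomp Require Import all_classical all_reals all_analysis.
From mathcomp Require Import measurable_realfun ring lra.

Set Implicit Arguments.
Unset Strict Implicit.
Unset Printing Implicit Defensive.

Import Order.TTheory GRing.Theory Num.Theory.
Import numFieldNormedType.Exports.

Local Open Scope classical_set_scope.
Local Open Scope ring_scope.

(** By the Hahn-Banach theorem, a bound on the Clarke subdifferential at [x] bounds the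
    Clarke directional derivative at [x], and a supremum argument along a segment turns
    this into [|f a - f b| <= (R1 (|a| + |b - a|)^m + R2) |a - b|]. Convexity of
    [t |-> t^m] then bounds [|f (x + s u) - f (y + s u)|] by a combination of [1] and
    [|u|^m], and part (i) follows from [E |u|^p <= (p + d)^(p/2)]. For part (ii), the
    Cameron-Martin formula [E g(u + b) = E (g(u) e^(b.u - |b|^2 / 2))] moves the increment
    of [x] from [f] to the Gaussian weight, which can be expanded to second order:
    [grad f_s (x) = s^-1 E (u f(x + s u))]. The bound on the gradient then follows as in
    (i), with an additional factor [|u|] under the expectation.

    All iterated integrals are of functions [g] with [|g x| <= C e^(k |x|_1)] and
    [|g x - g y| <= C e^(k (|x|_1 + |y|_1)) |x - y|_1]; this class is stable under slicing
    and partial integration, so that no joint measurability is needed. *)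

(** * Euclidean norm *)

Section EuclideanNorm.
Context {R : realType} {d : nat}.
Implicit Types (x y z : 'rV[R]_d) (a : R).

Lemma dotvC x y : dotv x y = dotv y x.
Proof. by apply: eq_bigr => i _; rewrite mulrC. Qed.

Lemma dotvDl x y z : dotv (x + y) z = dotv x z + dotv y z.
Proof. by rewrite -big_split; apply: eq_bigr => i _; rewrite mxE mulrDl. Qed.

Lemma dotvDr x y z : dotv x (y + z) = dotv x y + dotv x z.
Proof. by rewrite dotvC dotvDl !(dotvC x). Qed.

Lemma dotvZl a x y : dotv (a *: x) y = a * dotv x y.
Proof. by rewrite mulr_sumr; apply: eq_bigr => i _; rewrite mxE mulrA. Qed.

Lemma dotvZr a x y : dotv x (a *: y) = a * dotv x y.
Proof. by rewrite dotvC dotvZl dotvC. Qed.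

Lemma dotvNr x y : dotv x (- y) = - dotv x y.
Proof. by rewrite -scaleN1r dotvZr mulN1r. Qed.

Lemma enorm_ge0 x : 0 <= enorm x.
Proof. exact: sqrtr_ge0. Qed.

Lemma enorm_sqr x : enorm x ^+ 2 = dotv x x.
Proof.
rewrite sqr_sqrtr; first by apply: eq_bigr => i _; rewrite expr2.
by apply: sumr_ge0 => i _; exact: sqr_ge0.
Qed.

Lemma enormZ a x : enorm (a *: x) = `|a| * enorm x.
Proof.
apply/eqP; rewrite -(@eqrXn2 _ 2) ?mulr_ge0 ?enorm_ge0//.
by rewrite exprMn !enorm_sqr dotvZl dotvZr mulrA real_normK ?num_real// expr2.
Qed.

Lemma enormN x : enorm (- x) = enorm x.
Proof. by rewrite -scaleN1r enormZ normrN1 mul1r. Qed.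

Lemma enormBC x y : enorm (x - y) = enorm (y - x).
Proof. by rewrite -opprB enormN. Qed.

Lemma enorm0 : enorm (0 : 'rV[R]_d) = 0.
Proof. by rewrite -(scale0r 0) enormZ normr0 mul0r. Qed.

Lemma enorm_coord x i : `|x ord0 i| <= enorm x.
Proof.
rewrite -sqrtr_sqr ler_sqrt; last by apply: sumr_ge0 => j _; exact: sqr_ge0.
by rewrite (bigD1 i)//= lerDl sumr_ge0// => j _; exact: sqr_ge0.
Qed.

Lemma enorm0_eq0 x : enorm x = 0 -> x = 0.
Proof.
move=> x0; apply/rowP => i; rewrite mxE; apply/eqP; rewrite -normr_le0.
by rewrite -x0 enorm_coord.
Qed.

(** For nonzero vectors the squared norm of [|y| x - |x| y] is nonnegative and expands to
    [2 |x| |y| (|x| |y| - x.y)]. *)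
Lemma dotv_le_enorm x y : dotv x y <= enorm x * enorm y.
Proof.
have [x0|x0] := eqVneq (enorm x) 0.
  by rewrite (enorm0_eq0 x0) -(scale0r 0) dotvZl mul0r enormZ normr0 !mul0r.
have [y0|y0] := eqVneq (enorm y) 0.
  by rewrite (enorm0_eq0 y0) -(scale0r 0) dotvZr mul0r enormZ normr0 mul0r mulr0.
have xp : 0 < enorm x by rewrite lt_neqAle eq_sym x0 enorm_ge0.
have yp : 0 < enorm y by rewrite lt_neqAle eq_sym y0 enorm_ge0.
have := sqr_ge0 (enorm (enorm y *: x - enorm x *: y)).
rewrite enorm_sqr !(dotvDl, dotvDr) -scaleNr !(dotvZl, dotvZr) (dotvC y x).
rewrite -!enorm_sqr => H.
have {H} : 0 <= (2 * enorm x * enorm y) * (enorm x * enorm y - dotv x y).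
  by move: H; congr (_ <= _); ring.
by rewrite pmulr_rge0 ?subr_ge0// !mulr_gt0.
Qed.

Lemma normr_dotv_le x y : `|dotv x y| <= enorm x * enorm y.
Proof.
rewrite ler_norml dotv_le_enorm andbT lerNl -dotvNr -(enormN y).
exact: dotv_le_enorm.
Qed.

Lemma enormD x y : enorm (x + y) <= enorm x + enorm y.
Proof.
rewrite -(@ler_pXn2r _ 2)// ?nnegrE ?addr_ge0 ?enorm_ge0//.
rewrite enorm_sqr !(dotvDl, dotvDr) (dotvC y x) -!enorm_sqr.
by have := dotv_le_enorm x y; lra.
Qed.

Lemma enorm_triangle y x z : enorm (x - z) <= enorm (x - y) + enorm (y - z).
Proof. by rewrite -[x - z](subrKA y) enormD. Qed.

Lemma enorm_sub_le x y : enorm x - enorm y <= enorm (x - y).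
Proof. by rewrite lerBlDr -{1}(subrK y x) enormD. Qed.

End EuclideanNorm.

(** * Sublinear functionals *)

Section HahnBanach.
Context {R : realType} {V : lmodType R}.
Implicit Types (p q : V -> R) (v w : V).

(** Homogeneity is asked as an inequality only: the reverse one follows by scaling back with
    [s^-1]. *)
Definition sublinear p :=
  (forall v w, p (v + w) <= p v + p w) /\
  (forall s v, 0 < s -> p (s *: v) <= s * p v).

Lemma sublinearZ p s v : sublinear p -> 0 < s -> p (s *: v) = s * p v.
Proof.
move=> [_ pZ] s0; apply/eqP; rewrite eq_le pZ//=.
have := pZ s^-1 (s *: v); rewrite invr_gt0 scalerA mulVf ?gt_eqF// scale1r.
by move=> /(_ s0); rewrite -ler_pdivrMl ?invr_gt0// invrK.
Qed.

Lemma sublinear0 p : sublinear p -> p 0 = 0.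
Proof.
by move=> sp; have := sublinearZ 0 sp (ltr0n R 2); rewrite scaler0; lra.
Qed.

Lemma sublinearN p v : sublinear p -> - p (- v) <= p v.
Proof. by move=> sp; have := sp.1 v (- v); rewrite subrr sublinear0//; lra. Qed.

(* [q v = inf_(s >= 0) (p (v + s w) - s p w)] *)
Lemma sublinear_reduction p w : sublinear p ->
  exists q, [/\ sublinear q, forall v, q v <= p v & q (- w) <= - p w].
Proof.
move=> sp.
pose A v := [set r : R | exists2 s, 0 <= s & r = p (v + s *: w) - s * p w].
have A0 v : A v (p v).
  by exists 0; rewrite ?lexx// scale0r mul0r addr0 subr0.
(* The infimum is finite because [s p w = p (s w) <= p (v + s w) + p (- v)]. *)
have lbA v : lbound (A v) (- p (- v)).
  move=> _ [s s0 ->]; case: ltgtP s0 => // [s0 _|<- _]; last first.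
    by rewrite scale0r addr0 mul0r subr0; exact: sublinearN.
  have := sp.1 (v + s *: w) (- v); rewrite addrAC subrr add0r.
  by rewrite (sublinearZ _ sp s0); lra.
have hA v : has_inf (A v) by split; [exists (p v)|exists (- p (- v))].
have le_q v r : A v r -> inf (A v) <= r.
  by apply: ge_inf; case: (hA v).
have q_le v r : (forall x, A v x -> r <= x) -> r <= inf (A v).
  by move=> h; apply: lb_le_inf => //; case: (hA v).
exists (fun v => inf (A v)); split.
- split.
    move=> v v'; rewrite -lerBlDr; apply: (q_le _ _) => _ [s s0 ->].
    rewrite lerBlDr -lerBlDl; apply: (q_le _ _) => _ [s' s0' ->].
    rewrite lerBlDl; apply: (@le_trans _ _ (p (v + v' + (s + s') *: w) - (s + s') * p w)).
      by apply: (le_q _ _); exists (s + s') => //; rewrite addr_ge0.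
    have := sp.1 (v + s *: w) (v' + s' *: w).
    by rewrite addrACA -scalerDl; lra.
  move=> s v s0; rewrite -ler_pdivrMl//; apply: (q_le _ _) => _ [t t0 ->].
  rewrite ler_pdivrMl//; apply: (le_q _ _); exists (s * t); first by rewrite mulr_ge0// ltW.
  by rewrite -scalerA -scalerDr (sublinearZ _ sp s0); ring.
- by move=> v; apply: (le_q _ _); exact: A0.
- apply: (le_q _ _); exists 1; rewrite ?ler01// scale1r addNr sublinear0//.
  by rewrite mul1r sub0r.
Qed.

(** The functional is made odd at one vector after another. Oddness survives later reductions: if
    [q' <= q <= p] and [q (- w) <= - p w], then [q' (- w) <= - q' w]. *)
Lemma sublinear_reduction_seq p (ws : seq V) : sublinear p ->
  exists q, [/\ sublinear q, forall v, q v <= p v &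
             forall w, w \in ws -> q (- w) <= - q w].
Proof.
elim: ws p => [|w ws IH] p sp; first by exists p; split.
have [q [sq qp qw]] := sublinear_reduction w sp.
have [q' [sq' q'q q'ws]] := IH _ sq.
exists q'; split=> // [v|v]; first exact: le_trans (qp v).
rewrite inE => /orP[/eqP ->|]; last exact: q'ws.
by have := q'q (- w); have := q'q w; have := qp w; lra.
Qed.

End HahnBanach.

(** Finite-dimensional Hahn-Banach. A first reduction at [v] forces the value [p v] there;
    reductions at the basis vectors then make the functional linear. *)
Lemma sublinear_support {R : realType} {d : nat} (p : 'rV[R]_d -> R) (v : 'rV[R]_d) :
  sublinear p ->
  exists2 zeta : 'rV[R]_d, (forall u, dotv zeta u <= p u) & p v <= dotv zeta v.
Proof.
move=> sp; have [q0 [sq0 q0p q0v]] := sublinear_reduction v sp.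
have [q [sq qq0 qe]] :=
  sublinear_reduction_seq [seq delta_mx ord0 i | i <- enum 'I_d] sq0.
have qN i : q (- delta_mx ord0 i) = - q (delta_mx ord0 i).
  apply/eqP; rewrite eq_le qe/=; last by rewrite map_f// mem_enum.
  by have := sublinearN (delta_mx ord0 i) sq; lra.
have qZ c i : q (c *: delta_mx ord0 i) = c * q (delta_mx ord0 i).
  case: (ltgtP c 0) => [c0|c0|->].
  - by rewrite -[c]opprK scaleNr -scalerN (sublinearZ _ sq) ?oppr_gt0// qN mulrN -mulNr.
  - by rewrite (sublinearZ _ sq).
  - by rewrite scale0r mul0r sublinear0.
pose zeta : 'rV[R]_d := \row_i q (delta_mx ord0 i).
(* Subadditivity along the basis gives one inequality; applied to [- u], it gives the other. *)
have qs u : q u <= dotv zeta u.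
  rewrite {1}(row_sum_delta u) /dotv.
  elim/big_ind2 : _ => [|a b a' b' h h'|i _]; first by rewrite sublinear0.
    by apply: le_trans (sq.1 _ _) _; exact: lerD.
  by rewrite qZ mxE mulrC.
have zq u : dotv zeta u <= q u.
  have := qs (- u); rewrite dotvNr => h.
  by have := sublinearN u sq; lra.
exists zeta => [u|]; first by apply: le_trans (zq u) _; exact: le_trans (q0p u).
have := qs (- v); rewrite dotvNr => h.
have h1 := sublinearN v sq.
by have := qq0 (- v); have := zq v; have := zq (- v); rewrite dotvNr; lra.
Qed.

(** * Clarke subdifferential and Lipschitz estimates *)

Section ClarkeDerivative.
Context {R : realType} {d : nat}.
Implicit Types (f g : 'rV[R]_d -> R) (x y v w zeta : 'rV[R]_d) (c t s : R).

Definition eventual_slope_le f x v c := exists2 delta, 0 < delta &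
  forall y t, enorm (y - x) < delta -> 0 < t < delta -> f (y + t *: v) - f y <= t * c.

Lemma eventual_slope_leW f x v c c' : c <= c' ->
  eventual_slope_le f x v c -> eventual_slope_le f x v c'.
Proof.
move=> cc' [e e0 h]; exists e => // y t yx /andP[t0 te].
by apply: le_trans (h y t yx _) _; rewrite ?t0// ler_pM2l.
Qed.

(** The increment along [v + w] is split at [y + t v], which becomes the base point of the step
    along [w]. *)
Lemma eventual_slope_leD f x v w c c' :
  eventual_slope_le f x v c -> eventual_slope_le f x w c' ->
  eventual_slope_le f x (v + w) (c + c').
Proof.
move=> [e e0 h] [e' e0' h'].
have v1 : 0 < 1 + enorm v by rewrite ltr_pwDl// enorm_ge0.
(* With these radii [y + t v] stays within [e'] of [x]; adding 1 to [enorm v] avoids a division by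
   zero. *)
exists (Num.min e (Num.min (e' / 2) (e' / 2 / (1 + enorm v)))).
  by rewrite !lt_min e0 !divr_gt0.
move=> y t; rewrite !lt_min => /and3P[ye ye' _] /andP[t0 /and3P[te te' tv]].
have h1 := h y t ye; rewrite t0 te in h1; have {}h1 := h1 isT.
have : f (y + t *: v + t *: w) - f (y + t *: v) <= t * c'.
  apply: h'; last by rewrite t0/=; lra.
  rewrite addrAC; apply: le_lt_trans (enormD _ _) _.
  rewrite enormZ gtr0_norm//.
  have : t * enorm v <= e' / 2.
    have : t * (1 + enorm v) <= e' / 2 by rewrite -ler_pdivlMr// ltW.
    by rewrite mulrDr mulr1; lra.
  lra.
rewrite scalerDr addrA; lra.
Qed.

Lemma eventual_slope_leZ f x v s c : 0 < s ->
  eventual_slope_le f x v c -> eventual_slope_le f x (s *: v) (s * c).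
Proof.
move=> s0 [e e0 h]; exists (Num.min e (e / s)); first by rewrite lt_min e0 divr_gt0.
move=> y t; rewrite !lt_min => /andP[ye _] /andP[t0 /andP[te ts]].
rewrite scalerA mulrA; apply: h => //.
by rewrite mulr_gt0//= -ltr_pdivlMr.
Qed.

(** Real-valued counterpart of the Clarke directional derivative: a limsup is the infimum of the
    eventual upper bounds. It is used for locally Lipschitz [f], where the Hahn-Banach argument over
    the reals applies to it. *)
Definition dir_slope f x v : R := inf [set c | eventual_slope_le f x v c].

Lemma small_step_exists x (e : R) : 0 < e -> exists y t,
  [/\ enorm (y - x) < e, 0 < t & t < e].
Proof.
by move=> e0; exists x, (e / 2); rewrite subrr enorm0 e0; split=> //; lra.
Qed.

(** Near [x] all slopes lie between [- |L| |v|] and [|L| |v|]: the upper bound makes the set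
    nonempty, the lower one bounds it from below. The sign of [L] is unknown, hence [|L|]. *)
Lemma has_inf_dir_slope f x v : locally_lipschitz f ->
  has_inf [set c | eventual_slope_le f x v c].
Proof.
move=> lf; have [L [e e0 Lf]] := lf x.
have v1 : 0 < 1 + enorm v by rewrite ltr_pwDl// enorm_ge0.
have near_x y t : enorm (y - x) < e / 2 -> 0 < t < e / 2 / (1 + enorm v) ->
    enorm (y + t *: v - x) < e /\ enorm (y - x) < e.
  move=> ye /andP[t0 te]; split; last by lra.
  rewrite addrAC; apply: le_lt_trans (enormD _ _) _; rewrite enormZ gtr0_norm//.
  have : t * (1 + enorm v) <= e / 2 by rewrite -ler_pdivlMr// ltW.
  by rewrite mulrDr mulr1; lra.
split.
  exists (`|L| * enorm v); exists (Num.min (e / 2) (e / 2 / (1 + enorm v))).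
    by rewrite lt_min !divr_gt0.
  move=> y t; rewrite !lt_min => /andP[ye _] /and3P[t0 _ te].
  have [h1 h2] : enorm (y + t *: v - x) < e /\ enorm (y - x) < e.
    by apply: near_x => //; rewrite t0.
  apply: le_trans (ler_norm _) _; apply: le_trans (Lf _ _ h1 h2) _.
  rewrite addrAC subrr add0r enormZ gtr0_norm// mulrCA ler_pM2l//.
  by rewrite ler_wpM2r ?enorm_ge0// ler_norm.
exists (- (`|L| * enorm v)) => c [e' e0' h].
have [y [t [ye t0 te]]] := @small_step_exists x
  (Num.min e' (Num.min (e / 2) (e / 2 / (1 + enorm v))))
  ltac:(by rewrite !lt_min e0' !divr_gt0).
move: ye te; rewrite !lt_min => /and3P[ye ye1 ye2] /and3P[te te1 te2].
have h1 : f (y + t *: v) - f y <= t * c by apply: h => //; rewrite t0.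
have [h3 h2] : enorm (y + t *: v - x) < e /\ enorm (y - x) < e.
  by apply: near_x => //; rewrite t0.
have := Lf _ _ h3 h2; rewrite (addrAC y) subrr add0r enormZ (gtr0_norm t0) => h4.
have h5 : L * (t * enorm v) <= t * (`|L| * enorm v).
  by rewrite mulrCA ler_pM2l// ler_wpM2r ?enorm_ge0// ler_norm.
have : - (t * (`|L| * enorm v)) <= t * c.
  by apply: le_trans h1; rewrite lerNl; apply: le_trans h5; apply: le_trans h4;
     rewrite -normrN ler_norm.
by rewrite -mulrN ler_pM2l.
Qed.

Lemma dir_slope_lt f x v c : locally_lipschitz f ->
  dir_slope f x v < c -> eventual_slope_le f x v c.
Proof.
move=> lf /(inf_lt (has_inf_dir_slope x v lf).1)[c' h /ltW c'c].
exact: eventual_slope_leW c'c h.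
Qed.

Lemma dir_slope_ge f x v c : locally_lipschitz f ->
  eventual_slope_le f x v c -> dir_slope f x v <= c.
Proof. by move=> lf h; apply: ge_inf h; exact: (has_inf_dir_slope x v lf).2. Qed.

Lemma sublinear_dir_slope f x : locally_lipschitz f -> sublinear (dir_slope f x).
Proof.
move=> lf; split=> [v w|s v s0].
  apply/ler_addgt0Pr => e e0; apply: dir_slope_ge => //.
  have -> : dir_slope f x v + dir_slope f x w + e =
    (dir_slope f x v + e / 2) + (dir_slope f x w + e / 2) by lra.
  by apply: eventual_slope_leD; apply: dir_slope_lt => //; rewrite ltrDl divr_gt0.
rewrite -ler_pdivrMl//; apply/ler_addgt0Pr => e e0; rewrite ler_pdivrMl//.
apply: dir_slope_ge => //; apply: eventual_slope_leZ => //.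
by apply: dir_slope_lt => //; rewrite ltrDl.
Qed.

(** Each finite supremum over a [delta]-neighbourhood is an eventual bound. Through this inequality,
    a vector dominated by [dir_slope] belongs to the Clarke subdifferential. *)
Lemma dir_slope_le_clarke_dir f x v : locally_lipschitz f ->
  ((dir_slope f x v)%:E <= clarke_dir f x v)%E.
Proof.
move=> lf; apply: le_ereal_inf_tmp => _ [e /= e0 <-].
(* The value [+oo] is trivial, and [-oo] is excluded because admissible pairs [y], [t] exist. *)
set S := [set r | _]; case E : (ereal_sup S) => [c| |]; last 2 first.
- exact: leey.
- have [y [t [ye t0 te]]] := @small_step_exists x e e0.
  have : (((f (y + t *: v) - f y) / t)%:E <= ereal_sup S)%E.
    by apply: ereal_sup_ubound; exists y, t; rewrite t0 te.
  by rewrite E leeNy_eq.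
rewrite lee_fin; apply: dir_slope_ge => //; exists e => // y t ye /andP[t0 te].
have : (((f (y + t *: v) - f y) / t)%:E <= ereal_sup S)%E.
  by apply: ereal_sup_ubound; exists y, t; rewrite t0 te.
by rewrite E lee_fin ler_pdivrMr// mulrC.
Qed.

(** The supporting vector of [dir_slope f x] at [v] lies in the subdifferential, so [L] bounds its
    norm and Cauchy-Schwarz concludes. *)
Lemma dir_slope_bound f x v L : locally_lipschitz f ->
  (forall zeta, clarke_subdiff f x zeta -> enorm zeta <= L) ->
  dir_slope f x v <= L * enorm v.
Proof.
move=> lf hL; have [zeta z1 z2] := sublinear_support v (sublinear_dir_slope x lf).
apply: le_trans z2 _; apply: le_trans (dotv_le_enorm _ _) _.
rewrite ler_wpM2r ?enorm_ge0//; apply: hL => u.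
by apply: le_trans (dir_slope_le_clarke_dir x u lf); rewrite lee_fin.
Qed.

(** Supremum argument on the parameters [s] up to which the bound holds. The slope bound at the
    supremum [z] covers all base points near [z], so a point of [S] just below [z] serves as the
    start of a step beyond [z]. *)
Lemma mean_value_slope f x v c :
  (forall s, 0 <= s <= 1 -> eventual_slope_le f (x + s *: v) v c) ->
  f (x + v) - f x <= c.
Proof.
move=> h; pose S := [set s : R | 0 <= s <= 1 /\ f (x + s *: v) - f x <= s * c].
have S0 : S 0 by rewrite /S/= lexx ler01 scale0r addr0 subrr mul0r.
have S1 : ubound S 1 by move=> s [/andP[]].
have hS : has_sup S by split; [exists 0|exists 1].
pose z := sup S.
have z0 : 0 <= z by apply: sup_upper_bound.
have z1 : z <= 1 by apply: ge_sup => //; exists 0.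
have [e e0 he] := h z ltac:(by rewrite z0 z1).
have v1 : 0 < 1 + enorm v by rewrite ltr_pwDl// enorm_ge0.
(* The start [s] is less than [r] below [z] and the target at most [r / 2] above it, a step shorter
   than [e]; the second bound keeps the base point within [e] of [x + z v]. *)
pose r := Num.min (e / 2) (e / 2 / (1 + enorm v)).
have r0 : 0 < r by rewrite lt_min !divr_gt0.
have re : r <= e / 2 by rewrite ge_min lexx.
have rv : r * enorm v < e.
  have : r <= e / 2 / (1 + enorm v) by rewrite ge_min lexx orbT.
  rewrite ler_pdivlMr// mulrDr mulr1 => ?; lra.
have [s [/andP[s0 s1] sS] rs] := sup_adherent r0 hS; rewrite -/z in rs.
have sz : s <= z by apply: sup_upper_bound => //; split=> //; rewrite s0.
have ys : enorm (x + s *: v - (x + z *: v)) < e.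
  rewrite opprD addrACA subrr add0r -scalerBl enormZ ler0_norm ?subr_le0// opprB.
  by apply: le_lt_trans rv; rewrite ler_wpM2r ?enorm_ge0//; lra.
have step s' : s < s' -> s' <= 1 -> s' < s + e -> S s'.
  move=> ss' s1' se; split; first by lra.
  have := he _ (s' - s) ys ltac:(by lra).
  by rewrite -addrA -scalerDl (addrC s) subrK; lra.
have [lt1|] := ltP s 1; last first.
  move=> s1'; have s1E : s = 1 by lra.
  by move: sS; rewrite s1E scale1r mul1r.
(* Either 1 is within reach and the claim follows, or a point of [S] beyond its supremum appears. *)
have [big|small] := leP 1 (z + r / 2).
  have [] := step 1 lt1 (lexx _) ltac:(by lra).
  by rewrite scale1r mul1r.
have : S (z + r / 2) by apply: step; lra.
by move/(sup_upper_bound hS); rewrite -/z; lra.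
Qed.

End ClarkeDerivative.

(** The mean value inequality is used along the segment in both directions; its points have norm at
    most [|x| + |y - x|], which makes the slope bound uniform. The slack [e] gives the strict
    inequality required by [dir_slope_lt]. *)
Lemma SPB_lipschitz {R : realType} {d : nat} (f : 'rV[R]_d -> R) (R1 R2 : R) (m : nat)
    (x y : 'rV[R]_d) : SPB_with f R1 R2 m ->
  `|f x - f y| <= (R1 * (enorm x + enorm (y - x)) ^+ m + R2) * enorm (x - y).
Proof.
move=> [R10 R20 _ lf hf]; set L := R1 * _ + R2.
have one a b : (forall s, 0 <= s <= 1 ->
    enorm (a + s *: (b - a)) <= enorm x + enorm (y - x)) ->
    f b - f a <= L * enorm (b - a).
  move=> hs; rewrite -{1}(subrKC a b); apply/ler_addgt0Pr => e e0.
  apply: mean_value_slope => s s01; apply: dir_slope_lt => //.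
  apply: (@le_lt_trans _ _ (L * enorm (b - a))); last by rewrite ltrDl.
  apply: dir_slope_bound => // zeta /hf h; apply: le_trans h _.
  by rewrite lerD2r ler_wpM2l// lerXn2r ?nnegrE ?enorm_ge0 ?addr_ge0 ?enorm_ge0 ?hs.
rewrite ler_norml; apply/andP; split.
  rewrite lerNl opprB enormBC; apply: one => s /andP[s0 s1].
  apply: le_trans (enormD _ _) _; rewrite lerD2l enormZ ger0_norm//.
  by rewrite ler_piMl ?enorm_ge0.
apply: one => s /andP[s0 s1].
have -> : y + s *: (x - y) = x + (1 - s) *: (y - x).
  by rewrite scalerBl scale1r -scalerN opprB addrCA subrKA addrC.
apply: le_trans (enormD _ _) _; rewrite lerD2l enormZ ger0_norm ?subr_ge0//.
by rewrite ler_piMl ?enorm_ge0//; lra.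
Qed.

(** * From Lipschitz estimates of polynomial growth back to the SPB property *)

Lemma exprD_le_expr2 {R : realType} (a b : R) (m : nat) : 0 <= a -> 0 <= b ->
  (a + b) ^+ m <= 2 ^+ m * (a ^+ m + b ^+ m).
Proof.
move=> a0 b0; wlog ab : a b a0 b0 / a <= b.
  by move=> H; case: (leP a b) => [|/ltW] ab; [exact: H|rewrite addrC [in leRHS]addrC; exact: H].
apply: (@le_trans _ _ ((2 * b) ^+ m)).
  by rewrite lerXn2r ?nnegrE ?addr_ge0 ?mulr_ge0//; lra.
by rewrite exprMn ler_wpM2l ?exprn_ge0// lerDr exprn_ge0.
Qed.

(* Exponent [m.+1] in place of [m], together with [+ 1], gives the side condition
   [R1 = 0 <-> m = 0] for free. *)
Lemma SPB_of_lipschitz {R : realType} {d : nat} (g : 'rV[R]_d -> R) (A B C : R) (m : nat) :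
  0 <= A -> 0 <= B -> 0 <= C ->
  (forall x y, `|g x - g y| <=
     (A + B * enorm x ^+ m + C * enorm (y - x) ^+ m) * enorm (x - y)) ->
  SPB g.
Proof.
move=> A0 B0 C0 hg.
pose K := B * 2 ^+ m.
have K0 : 0 <= K by rewrite mulr_ge0// exprn_ge0.
exists (K + 1), (A + 2 * K + C + 1), m.+1; split.
- by rewrite addr_ge0.
- by lra.
- by split=> // K1; exfalso; lra.
- move=> x; exists (A + B * (enorm x + 1) ^+ m + C * 2 ^+ m), 1 => // y z y1 z1.
  apply: le_trans (hg y z) _; rewrite ler_wpM2r ?enorm_ge0//.
  apply: lerD; [rewrite lerD2l|]; apply: ler_wpM2l => //; apply: lerXn2r;
    rewrite ?nnegrE ?enorm_ge0 ?addr_ge0 ?enorm_ge0//.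
    by have := enorm_sub_le y x; lra.
  by have := enorm_triangle x z y; rewrite (enormBC x y); lra.
move=> x zeta hz.
have z1 : 0 < 1 + enorm zeta by rewrite ltr_pwDl// enorm_ge0.
(* A Lipschitz bound for steps of length at most 1 from base points within distance 1 of [x]. *)
pose Q := A + B * (enorm x + 1) ^+ m + C.
have QK : Q <= (K + 1) * enorm x ^+ m.+1 + (A + 2 * K + C + 1).
  have h1 := @exprD_le_expr2 R (enorm x) 1 m (enorm_ge0 x) ler01.
  have h2 : enorm x ^+ m <= 1 + enorm x ^+ m.+1.
    have [x1|x1] := leP (enorm x) 1.
      by rewrite (@le_trans _ _ 1)// ?exprn_ile1 ?enorm_ge0// lerDl exprn_ge0 ?enorm_ge0.
    by rewrite (@le_trans _ _ (enorm x ^+ m.+1)) ?lerDr// ler_weXn2l// ltW.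
  have h3 : B * (enorm x + 1) ^+ m <= K * (enorm x ^+ m + 1).
    by rewrite -mulrA ler_wpM2l//; rewrite expr1n in h1.
  have h4 : K * (enorm x ^+ m + 1) <= K * (2 + enorm x ^+ m.+1).
    by rewrite ler_wpM2l//; lra.
  have h5 : 0 <= enorm x ^+ m.+1 by rewrite exprn_ge0 ?enorm_ge0.
  by rewrite /Q; lra.
apply: le_trans QK.
(* Testing [zeta] in its own direction: [|zeta|^2] is at most the directional derivative along
   [zeta], hence at most [Q |zeta|]. *)
have cd : (clarke_dir g x zeta <= (Q * enorm zeta)%:E)%E.
  pose e := Num.min 1 (1 + enorm zeta)^-1.
  apply: ge_ereal_inf; eexists.
    by exists e; first by rewrite /= lt_min ltr01 invr_gt0.
  apply: ge_ereal_sup => _ [y [t [ye /andP[t0 te] ->]]].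
  rewrite lee_fin ler_pdivrMr//.
  apply: le_trans (ler_norm _) _; rewrite distrC; apply: le_trans (hg _ _) _.
  rewrite -[y + _ - y]addrAC subrr add0r opprD addrA subrr add0r enormN enormZ gtr0_norm//.
  rewrite -(mulrA Q) (mulrC (enorm zeta)) ler_wpM2r ?mulr_ge0 ?enorm_ge0 ?(ltW t0)//.
  move: ye te; rewrite !lt_min => /andP[y1 _] /andP[_ te].
  apply: lerD; [rewrite lerD2l|rewrite -[leRHS]mulr1]; apply: ler_wpM2l => //.
    apply: lerXn2r; rewrite ?nnegrE ?enorm_ge0 ?addr_ge0 ?enorm_ge0//.
    by have := enorm_sub_le y x; lra.
  rewrite exprn_ile1 ?mulr_ge0 ?enorm_ge0 ?(ltW t0)//.
  have : t * (1 + enorm zeta) <= 1 by rewrite -ler_pdivlMr// mul1r ltW.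
  by rewrite mulrDr mulr1; lra.
have := le_trans (hz zeta) cd; rewrite lee_fin -enorm_sqr expr2.
have [z0|z0] := eqVneq (enorm zeta) 0.
  by rewrite z0 => _; rewrite /Q addr_ge0// addr_ge0// mulr_ge0// exprn_ge0// addr_ge0 ?enorm_ge0.
by rewrite ler_pM2r// lt_neqAle eq_sym z0 enorm_ge0.
Qed.

(** * One-dimensional Gaussian integrals *)

Section NormalDensity.
Context {R : realType}.
Local Notation mu := (@lebesgue_measure R).
Local Notation N01 := (@normal_prob R 0 1).

(** The Radon-Nikodym derivative and the explicit density have the same integral over every
    measurable set, so they agree almost everywhere. *)
Lemma ge0_integral_normal_prob (f : R -> \bar R) : measurable_fun [set: R] f ->
  (forall x, 0 <= f x)%E ->
  (\int[N01]_x f x = \int[mu]_x (f x * (normal_pdf (0:R) 1 x)%:E))%E.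
Proof.
move=> mf f0; have dom := @normal_prob_dominates R 0 1.
rewrite -(Radon_Nikodym_SigmaFinite.change_of_variables dom)//.
have intf := Radon_Nikodym_SigmaFinite.f_integrable dom.
have mpdf : measurable_fun [set: R] (fun x => (normal_pdf (0:R) 1 x)%:E).
  by apply/measurable_EFinP; exact: measurable_normal_pdf.
apply: ae_eq_integral => //.
- by apply: emeasurable_funM => //; exact: measurable_int intf.
- exact: emeasurable_funM.
- apply: ae_eqe_mul2l; apply: integral_ae_eq => // E _ mE.
  by rewrite -(Radon_Nikodym_SigmaFinite.f_integral dom).
Qed.

Lemma normal_pdf01E (x : R) : normal_pdf 0 1 x = normal_peak 1 * expR (- (x ^+ 2 / 2)).
Proof.
rewrite normal_pdfE ?oner_eq0//; congr (_ * expR _).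
by rewrite subr0 expr1n mulNr.
Qed.

(** Multiplied by the standard density, the integrand is [s] times the centred normal density of
    standard deviation [s = (1 - lam)^(-1/2)]. *)
Lemma integral_expR_sqr (lam : R) : lam < 1 ->
  (\int[N01]_x (expR (lam * x ^+ 2 / 2))%:E = (Num.sqrt (1 - lam))^-1%:E)%E.
Proof.
move=> lam1; pose s := (Num.sqrt (1 - lam))^-1.
have s0 : 0 < s by rewrite invr_gt0 sqrtr_gt0 subr_gt0.
have s2 : s ^+ 2 = (1 - lam)^-1 by rewrite exprVn sqr_sqrtr// subr_ge0 ltW.
have l1 : 1 - lam != 0 by rewrite gt_eqF// subr_gt0.
rewrite ge0_integral_normal_prob; first last.
- by move=> x; rewrite lee_fin expR_ge0.
- apply/measurable_EFinP; apply: measurableT_comp => //=.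
  by apply: measurable_funM => //=; apply: measurable_funM => //=; apply: measurable_funX.
transitivity (\int[mu]_x (s%:E * (normal_pdf 0 s x)%:E))%E; last first.
  rewrite ge0_integralZl//=; first by rewrite integral_normal_pdf mule1.
  - by apply/measurable_EFinP; exact: measurable_normal_pdf.
  - by move=> x _; rewrite lee_fin normal_pdf_ge0.
  - by rewrite lee_fin ltW.
apply: eq_integral => x _; rewrite -!EFinM; congr EFin.
rewrite normal_pdf01E normal_pdfE ?gt_eqF// /normal_fun subr0.
rewrite mulrCA -expRD [RHS]mulrA; congr (_ * expR _).
  rewrite /normal_peak expr1n mul1r -mulrnAr sqrtrM ?sqr_ge0// sqrtr_sqr gtr0_norm//.
  by rewrite invfM mulrA divff ?gt_eqF// mul1r.
by rewrite s2; field.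
Qed.

(** Translation by [a] in the Lebesgue integral; the exponential weight is the ratio of the two
    Gaussian densities. *)
Lemma ge0_integral_normal_shift (f : R -> R) (a : R) : continuous f ->
  (forall x, 0 <= f x) ->
  (\int[N01]_x (f (x + a))%:E = \int[N01]_x (f x * expR (a * x - a ^+ 2 / 2))%:E)%E.
Proof.
move=> cf f0.
have cshift : continuous (fun x : R => x + a).
  by move=> x; apply: cvgD => //; exact: cvg_cst.
have cphi : continuous (fun x : R => f x * expR (a * x - a ^+ 2 / 2)).
  move=> x; apply: cvgM; first exact: cf.
  apply: continuous_comp; last exact: continuous_expR.
  apply: cvgB; last exact: cvg_cst.
  by apply: cvgM; [exact: cvg_cst|exact: cvg_id].
rewrite !ge0_integral_normal_prob; first last.
- by move=> x; rewrite lee_fin f0.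
- apply/measurable_EFinP; apply: continuous_measurable_fun => x.
  exact: (continuous_comp (cshift x) (cf _)).
- by move=> x; rewrite lee_fin mulr_ge0 ?expR_ge0.
- by apply/measurable_EFinP; exact: continuous_measurable_fun.
under [RHS]eq_integral do rewrite -EFinM.
have dF : (fun x : R => x + a)^`()%classic = cst 1.
  apply/funext => x; rewrite derive1E deriveD// derive_cst derive_id addr0//.
rewrite [RHS](@increasing_ge0_integration_by_substitutionT R (fun x => x + a)
  (fun x => f x * expR (a * x - a ^+ 2 / 2) * normal_pdf 0 1 x)).
- apply: eq_integral => x _; rewrite dF !fctE mulr1 -EFinM; congr EFin.
  rewrite !normal_pdf01E.
  have -> : expR (- (x ^+ 2 / 2)) =
      expR (a * (x + a) - a ^+ 2 / 2) * expR (- ((x + a) ^+ 2 / 2)).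
    by rewrite -expRD; congr expR; field.
  ring.
- by move=> x y; rewrite ltrD2r.
- by rewrite dF => x; exact: cvg_cst.
- by rewrite dF; exact: is_cvg_cst.
- by rewrite dF; exact: is_cvg_cst.
- by move=> x; apply: derivableD.
- exact: cvg_addrr_Ny.
- exact: cvg_addrr.
- move=> x; apply: cvgM; first exact: cphi.
  by apply: continuous_normal_pdf; rewrite oner_eq0.
- by move=> x; rewrite !mulr_ge0 ?expR_ge0 ?normal_pdf_ge0.
Qed.

End NormalDensity.

(** * Functions of exponential growth *)

Lemma normr_expRB {R : realType} (p q c : R) : p <= c -> q <= c ->
  `|expR p - expR q| <= expR c * `|p - q|.
Proof.
wlog pq : p q / q <= p.
  by move=> H; case: (leP q p) => [|/ltW] h hp hq;
    [exact: H|rewrite distrC (distrC p); exact: H].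
move=> pc _; rewrite !ger0_norm ?subr_ge0 ?ler_expR//.
apply: (@le_trans _ _ (expR p * (p - q))).
  have -> : expR q = expR p * expR (q - p) by rewrite -expRD subrKC.
  have := expR_ge1Dx (q - p); rewrite -(ler_pM2l (expR_gt0 p)); lra.
by rewrite ler_wpM2r ?subr_ge0// ler_expR.
Qed.

Lemma le_expR {R : realType} (x : R) : x <= expR x.
Proof. by have := expR_ge1Dx x; lra. Qed.

Section Tame.
Context {R : realType} {V : zmodType} (N : V -> R).
Implicit Types (f g : V -> R) (C k : R).

(** [N] is the absolute value on the line and the l1 norm on row vectors. On the line the first
    clause gives integrability, the second continuity and hence measurability. *)
Definition tame_with C k g :=
  (forall x, `|g x| <= C * expR (k * N x)) /\
  (forall x y, `|g x - g y| <= C * expR (k * (N x + N y)) * N (x - y)).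

Definition tame g := exists C k, [/\ 0 <= C, 0 <= k & tame_with C k g].

Hypothesis N_ge0 : forall x, 0 <= N x.

Lemma tame_withW C k C' k' g : 0 <= C -> C <= C' -> k <= k' ->
  tame_with C k g -> tame_with C' k' g.
Proof.
move=> C0 CC' kk' [h1 h2]; split=> [x|x y].
  apply: le_trans (h1 x) _; apply: ler_pM => //.
  by rewrite ler_expR ler_wpM2r.
apply: le_trans (h2 x y) _; rewrite ler_wpM2r//.
apply: ler_pM => //.
by rewrite ler_expR ler_wpM2r// addr_ge0.
Qed.

Lemma tame_cst c : tame (fun=> c).
Proof.
exists `|c|, 0; split=> //; split=> [x|x y]; first by rewrite mul0r expR0 mulr1.
by rewrite subrr normr0 !mulr_ge0 ?expR_ge0.
Qed.

Lemma tameD f g : tame f -> tame g -> tame (fun x => f x + g x).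
Proof.
move=> [C [k [C0 k0 fC]]] [C' [k' [C0' k0' gC]]].
exists (C + C'), (k + k'); split; rewrite ?addr_ge0//.
have [f1 f2] : tame_with C (k + k') f by apply: tame_withW fC => //; lra.
have [g1 g2] : tame_with C' (k + k') g by apply: tame_withW gC => //; lra.
split=> [x|x y].
  by rewrite mulrDl; apply: le_trans (ler_normD _ _) _; exact: lerD.
have := lerD (f2 x y) (g2 x y); set e := expR _ => h.
by rewrite opprD addrACA !mulrDl; apply: le_trans (ler_normD _ _) h.
Qed.

Lemma tameM f g : tame f -> tame g -> tame (fun x => f x * g x).
Proof.
move=> [C [k [C0 k0 [f1 f2]]]] [C' [k' [C0' k0' [g1 g2]]]].
exists (C * C' + C * C'), (k + k'); split; rewrite ?addr_ge0 ?mulr_ge0//.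
split=> [x|x y].
  rewrite normrM; apply: (@le_trans _ _ (C * C' * expR ((k + k') * N x))).
    rewrite mulrDl expRD mulrACA; apply: ler_pM => //.
  by rewrite ler_wpM2r ?expR_ge0// lerDl mulr_ge0.
have -> : f x * g x - f y * g y = f x * (g x - g y) + g y * (f x - f y) by ring.
apply: le_trans (ler_normD _ _) _; rewrite !normrM.
set e := expR _; rewrite !mulrDl; apply: lerD; rewrite {}/e.
  apply: le_trans (ler_pM (normr_ge0 _) (normr_ge0 _) (f1 x) (g2 x y)) _.
  rewrite [leLHS](_ : _ = C * C' * (expR (k * N x) * expR (k' * (N x + N y))) * N (x - y));
    last by ring.
  rewrite ler_wpM2r// ler_wpM2l ?mulr_ge0// -expRD ler_expR mulrDl lerD2r.
  by rewrite ler_wpM2l// lerDl.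
apply: le_trans (ler_pM (normr_ge0 _) (normr_ge0 _) (g1 y) (f2 x y)) _.
rewrite [leLHS](_ : _ = C * C' * (expR (k * (N x + N y)) * expR (k' * N y)) * N (x - y));
  last by ring.
rewrite ler_wpM2r// ler_wpM2l ?mulr_ge0// -expRD ler_expR mulrDl lerD2l.
by rewrite ler_wpM2l// lerDr.
Qed.

Lemma tameZ c g : tame g -> tame (fun x => c * g x).
Proof. by move=> tg; apply: tameM => //; exact: tame_cst. Qed.

Lemma tameB f g : tame f -> tame g -> tame (fun x => f x - g x).
Proof.
move=> tf tg; have -> : (fun x => f x - g x) = (fun x => f x + (-1) * g x).
  by apply/funext => x; rewrite mulN1r.
by apply: tameD => //; exact: tameZ.
Qed.

Lemma tameX g n : tame g -> tame (fun x => g x ^+ n).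
Proof.
move=> tg; elim: n => [|n IH]; first exact: tame_cst.
have -> : (fun x => g x ^+ n.+1) = (fun x => g x * g x ^+ n).
  by apply/funext => x; rewrite exprS.
exact: tameM.
Qed.

Lemma tame_norm g : tame g -> tame (fun x => `|g x|).
Proof.
move=> [C [k [C0 k0 [h1 h2]]]]; exists C, k; split=> //; split=> [x|x y].
  by rewrite normr_id.
by apply: le_trans (h2 x y); exact: ler_dist_dist.
Qed.

Hypothesis N0 : N 0 = 0.

(** Comparison with the value at 0 yields the growth bound; the factor [N x] is absorbed by
    [e^(N x)], whence [k + 1]. *)
Lemma tame_loclip C k g : 0 <= C -> 0 <= k ->
  (forall x y, `|g x - g y| <= C * expR (k * (N x + N y)) * N (x - y)) -> tame g.
Proof.
move=> C0 k0 h; exists (`|g 0| + C), (k + 1); split; rewrite ?addr_ge0//.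
split=> [x|x y]; last first.
  apply: le_trans (h x y) _; rewrite ler_wpM2r//; apply: ler_pM; rewrite ?expR_ge0 ?lerDr//.
  by rewrite ler_expR ler_wpM2r ?addr_ge0// lerDl.
have e1 : 1 <= expR ((k + 1) * N x).
  by rewrite -expR0 ler_expR mulr_ge0// addr_ge0.
have := h x 0; rewrite N0 subr0 addr0 => hx.
rewrite -(subrK (g 0) (g x)); apply: le_trans (ler_normD _ _) _.
rewrite addrC mulrDl; apply: lerD; first by rewrite ler_peMr.
apply: le_trans hx _; rewrite mulrDl mul1r expRD mulrA.
by rewrite ler_wpM2l ?mulr_ge0 ?expR_ge0// le_expR.
Qed.

Lemma tame_lip L g : 0 <= L -> (forall x y, `|g x - g y| <= L * N (x - y)) -> tame g.
Proof.
move=> L0 h; apply: (@tame_loclip L 0) => // x y.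
by rewrite mul0r expR0 mulr1.
Qed.

Lemma tame_expR c k g : 0 <= k -> (forall x, g x <= c + k * N x) ->
  (forall x y, `|g x - g y| <= k * N (x - y)) -> tame (fun x => expR (g x)).
Proof.
move=> k0 h1 h2; apply: (@tame_loclip (expR c * k) k); rewrite ?mulr_ge0 ?expR_ge0// => x y.
have -> : expR c * k * expR (k * (N x + N y)) * N (x - y) =
    expR (c + k * (N x + N y)) * (k * N (x - y)) by rewrite expRD; ring.
apply: (@le_trans _ _ (expR (c + k * (N x + N y)) * `|g x - g y|)).
  apply: normr_expRB; [apply: le_trans (h1 x) _|apply: le_trans (h1 y) _];
    by rewrite lerD2l ler_wpM2l// ?lerDl ?lerDr.
by rewrite ler_wpM2l ?expR_ge0.
Qed.

End Tame.

(** * Expectation of tame functions of one Gaussian variable *)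

Section Gauss1.
Context {R : realType}.
Local Notation N01 := (@normal_prob R 0 1).
Local Notation tame1 := (@tame R R (fun t : R => `|t|)).
Local Notation E1 g := (Rintegral N01 [set: R] g).
Implicit Types (f g : R -> R) (a c t lam : R).

Let nge0 t : 0 <= `|t|. Proof. exact: normr_ge0. Qed.
Let n0 : `|0 : R| = 0. Proof. exact: normr0. Qed.

Lemma tame1_continuous g : tame1 g -> continuous g.
Proof.
move=> [C [k [C0 k0 [_ h]]]] x; apply/cvgrPdist_le => e e0.
have K0 : 0 < C * expR (k * (`|x| + (`|x| + 1))) + 1.
  by rewrite ltr_wpDl// mulr_ge0 ?expR_ge0.
near=> y; apply: le_trans (h x y) _.
have xy : `|x - y| <= 1 by near: y; apply: cvgr_dist_le => //; exact: cvg_id.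
have xye : `|x - y| <= e / (C * expR (k * (`|x| + (`|x| + 1))) + 1).
  by near: y; apply: cvgr_dist_le; [exact: cvg_id|rewrite divr_gt0].
apply: (@le_trans _ _ ((C * expR (k * (`|x| + (`|x| + 1))) + 1) * `|x - y|)).
  rewrite ler_wpM2r//; apply: ler_wpDr => //; rewrite ler_wpM2l// ler_expR ler_wpM2l//.
  rewrite lerD2l -[y](subrK x); apply: le_trans (ler_normD _ _) _.
  by rewrite distrC addrC lerD2l.
by move: xye; rewrite ler_pdivlMr// mulrC.
Unshelve. all: by end_near. Qed.

Lemma tame1_measurable g : tame1 g -> measurable_fun [set: R] g.
Proof. by move=> /tame1_continuous; exact: continuous_measurable_fun. Qed.

Lemma integrable_expR_sqr lam : lam < 1 ->
  N01.-integrable [set: R] (EFin \o (fun x => expR (lam * x ^+ 2 / 2))).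
Proof.
move=> lam1; apply/integrableP; split.
  apply/measurable_EFinP; apply: measurableT_comp => //=.
  by apply: measurable_funM => //=; apply: measurable_funM => //=; apply: measurable_funX.
under eq_integral do rewrite /= ger0_norm ?expR_ge0//.
by rewrite integral_expR_sqr// ltry.
Qed.

(** Domination by a Gaussian exponential: [k |x| <= k^2 + x^2 / 4], from [(|x| / 2 - k)^2 >= 0]. *)
Lemma tame1_integrable g : tame1 g -> N01.-integrable [set: R] (EFin \o g).
Proof.
move=> tg; have mg := tame1_measurable tg.
have [C [k [C0 k0 [h _]]]] := tg.
apply: (@le_integrable _ _ _ N01 setT measurableT _
  (EFin \o (fun x => (C * expR (k ^+ 2)) * expR (2^-1 * x ^+ 2 / 2)))) => //.
- exact/measurable_EFinP.
- move=> x _ /=; rewrite lee_fin; apply: le_trans (h x) _.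
  apply: le_trans (ler_norm _); rewrite -mulrA ler_wpM2l// -expRD ler_expR.
  have := sqr_ge0 (`|x| / 2 - k); rewrite sqrrB expr_div_n real_normK ?num_real//; lra.
- apply: (integrableZl measurableT (C * expR (k ^+ 2)) (integrable_expR_sqr _)).
  by rewrite invf_lt1// ltr1n.
Qed.

Lemma E1_lin a f g : tame1 f -> tame1 g ->
  E1 (fun t => a * f t + g t) = a * E1 f + E1 g.
Proof.
move=> tf tg; rewrite RintegralD//=; last exact: tame1_integrable.
  by rewrite RintegralZl//; exact: tame1_integrable.
by apply: tame1_integrable; exact: tameZ.
Qed.

(** The majorant is only integrable, since [e^(lam t^2 / 2)] with [0 < lam < 1] grows too fast to be
    tame. *)
Lemma E1_le f g : tame1 f -> N01.-integrable [set: R] (EFin \o g) ->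
  (forall t, f t <= g t) -> E1 f <= E1 g.
Proof. by move=> tf ig fg; apply: le_Rintegral => //; exact: tame1_integrable. Qed.

Lemma E1_cst c : E1 (fun=> c) = c.
Proof. by rewrite Rintegral_cst//= probability_setT mulr1. Qed.

Lemma E1_expR_sqr lam : lam < 1 ->
  E1 (fun x => expR (lam * x ^+ 2 / 2)) = (Num.sqrt (1 - lam))^-1.
Proof. by move=> lam1; rewrite /Rintegral integral_expR_sqr. Qed.

Lemma tame1_shift g a : tame1 g -> tame1 (fun t => g (t + a)).
Proof.
move=> [C [k [C0 k0 [h1 h2]]]].
exists (C * expR (k * (`|a| + `|a|))), k; split; rewrite ?mulr_ge0 ?expR_ge0//.
split=> [x|x y].
  apply: le_trans (h1 _) _; rewrite -mulrA ler_wpM2l// -expRD ler_expR -mulrDr.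
  rewrite ler_wpM2l//; apply: le_trans (ler_normD _ _) _.
  by have := normr_ge0 a; lra.
apply: le_trans (h2 _ _) _; rewrite opprD addrACA subrr addr0 ler_wpM2r//.
rewrite -mulrA ler_wpM2l// -expRD ler_expR -mulrDr ler_wpM2l//.
by have := ler_normD x a; have := ler_normD y a; lra.
Qed.

Lemma tame1_tilt a : tame1 (fun t => expR (a * t - a ^+ 2 / 2)).
Proof.
apply: (@tame_expR _ _ _ nge0 n0 0 `|a|) => // [x|x y].
  rewrite add0r -normrM; have := ler_norm (a * x); have := sqr_ge0 a; lra.
by rewrite opprB addrA subrK -mulrBr normrM.
Qed.

(** The nonnegative case extends to signed functions by [g = (|g| + g) - |g|], both parts being
    tame. *)
Lemma E1_shift g a : tame1 g ->
  E1 (fun t => g (t + a)) = E1 (fun t => g t * expR (a * t - a ^+ 2 / 2)).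
Proof.
have pos f : tame1 f -> (forall x, 0 <= f x) ->
    E1 (fun t => f (t + a)) = E1 (fun t => f t * expR (a * t - a ^+ 2 / 2)).
  move=> tf f0; rewrite /Rintegral ge0_integral_normal_shift//.
  exact: tame1_continuous.
move=> tg; pose h t := `|g t| + g t.
have tn := tame_norm tg.
have th : tame1 h by exact: tameD.
have h0 t : 0 <= h t by rewrite /h -lerBlDr sub0r -normrN ler_norm.
have tT := tame1_tilt a.
have -> : (fun t => g (t + a)) = (fun t => (-1) * `|g (t + a)| + h (t + a)).
  by apply/funext => t; rewrite /h; ring.
have -> : (fun t => g t * expR (a * t - a ^+ 2 / 2)) =
   (fun t => (-1) * (`|g t| * expR (a * t - a ^+ 2 / 2)) + h t * expR (a * t - a ^+ 2 / 2)).
  by apply/funext => t; rewrite /h; ring.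
rewrite (@E1_lin _ (fun t => `|g (t + a)|) (fun t => h (t + a))); last 2 first.
- exact: (tame1_shift a tn).
- exact: tame1_shift.
rewrite E1_lin; [|exact: tameM|exact: tameM].
by rewrite (pos (fun t => `|g t|))// pos.
Qed.

Lemma tame1_id : tame1 id.
Proof. by apply: (@tame_lip _ _ _ nge0 n0 1) => // x y; rewrite mul1r. Qed.

(* [t^2 <= 2 (e^(lam t^2 / 2) - 1) / lam], and [lam -> 0]. *)
Lemma E1_sqr_le1 : E1 (fun t => t ^+ 2) <= 1.
Proof.
set c := E1 _; rewrite leNgt; apply/negP => c1.
have t2 : tame1 (fun t => t ^+ 2) by apply: (tameX nge0 2 tame1_id).
have key s : 0 < s < 1 -> c * (s * (1 + s)) <= 2.
  move=> /andP[s0 s1]; pose lam := 1 - s ^+ 2.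
  have l0 : 0 < lam by rewrite subr_gt0 expr_lt1// ltW.
  have l1 : lam < 1 by rewrite ltrBlDr ltrDl exprn_gt0.
  have h : E1 (fun t => lam / 2 * t ^+ 2 + 1) <= s^-1.
    have := E1_expR_sqr l1; rewrite /lam subKr sqrtr_sqr gtr0_norm// => <-.
    apply: E1_le; [|exact: integrable_expR_sqr|].
      apply: tameD => //; last exact: tame_cst.
      exact: tameZ.
    by move=> t; apply: le_trans (expR_ge1Dx _); rewrite addrC mulrAC.
  rewrite (@E1_lin _ (fun t => t ^+ 2) (fun=> 1)) in h; [|exact: t2|exact: tame_cst].
  rewrite E1_cst -/c -(ler_pM2r s0) mulVf ?gt_eqF// in h.
  have s10 : 0 < 1 - s by rewrite subr_gt0.
  by rewrite -(ler_pM2l s10); move: h; rewrite /lam; lra.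
have c0 : 0 < c by lra.
(* The midpoint of [1 / c] and 1 replaces the limit: there [key] would give
   [(c - 1) (3 c - 1) <= 0]. *)
pose s := (c + 1) / (2 * c).
have csE : c * s = (c + 1) / 2 by rewrite /s; field; rewrite gt_eqF.
have s01 : 0 < s < 1.
  by rewrite divr_gt0 ?mulr_gt0 ?addr_gt0//= ltr_pdivrMr ?mulr_gt0//; lra.
have := key s s01; rewrite mulrA csE -(ler_pM2l c0).
rewrite [leLHS](_ : _ = (c + 1) / 2 * (c + c * s)); last by ring.
rewrite csE; have : 0 < (c - 1) * (3 * c - 1) by rewrite mulr_gt0//; lra.
by lra.
Qed.

End Gauss1.

(** * Gaussian expectation in dimension [d] *)

Section NormOne.
Context {R : realType}.

(** The l1 norm is additive over [row_cons], so exponential weights factor over the coordinates. *)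
Definition norm1 d (x : 'rV[R]_d) : R := \sum_i `|x ord0 i|.

Definition row_cons d (t : R) (v : 'rV[R]_d) : 'rV[R]_d.+1 :=
  row_mx (const_mx t : 'rV[R]_1) v.

Definition row_tail d (x : 'rV[R]_d.+1) : 'rV[R]_d :=
  \row_i x ord0 (lift ord0 i).

Lemma row_cons_ord0 d t (v : 'rV[R]_d) : row_cons t v ord0 ord0 = t.
Proof.
by rewrite /row_cons mxE; case: splitP => [j _|j]; first by rewrite mxE.
Qed.

Lemma row_cons_lift d t (v : 'rV[R]_d) i : row_cons t v ord0 (lift ord0 i) = v ord0 i.
Proof.
rewrite /row_cons mxE; case: splitP => [j|j]; first by rewrite ord1.
by case => ij; congr (v _ _); apply/val_inj.
Qed.

Lemma row_consK d (x : 'rV[R]_d.+1) : row_cons (x ord0 ord0) (row_tail x) = x.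
Proof.
apply/rowP => i; case: (unliftP ord0 i) => [j|] ->.
  by rewrite row_cons_lift mxE.
by rewrite row_cons_ord0.
Qed.

Lemma row_consD d t s (v w : 'rV[R]_d) :
  row_cons (t + s) (v + w) = row_cons t v + row_cons s w.
Proof.
apply/rowP => i; case: (unliftP ord0 i) => [j|] ->.
  by rewrite [RHS]mxE !row_cons_lift mxE.
by rewrite [RHS]mxE !row_cons_ord0.
Qed.

Lemma row_consN d t (v : 'rV[R]_d) : row_cons (- t) (- v) = - row_cons t v.
Proof.
apply/rowP => i; case: (unliftP ord0 i) => [j|] ->.
  by rewrite [RHS]mxE !row_cons_lift mxE.
by rewrite [RHS]mxE !row_cons_ord0.
Qed.

Lemma norm1_row_cons d t (v : 'rV[R]_d) : norm1 (row_cons t v) = `|t| + norm1 v.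
Proof.
rewrite /norm1 big_ord_recl row_cons_ord0; congr (_ + _).
by apply: eq_bigr => i _; rewrite row_cons_lift.
Qed.

Lemma dotv_row_cons d t s (v w : 'rV[R]_d) :
  dotv (row_cons t v) (row_cons s w) = t * s + dotv v w.
Proof.
rewrite /dotv big_ord_recl !row_cons_ord0; congr (_ + _).
by apply: eq_bigr => i _; rewrite !row_cons_lift.
Qed.

Lemma norm1_ge0 d (x : 'rV[R]_d) : 0 <= norm1 x.
Proof. by apply: sumr_ge0. Qed.

Lemma norm10 d : norm1 (0 : 'rV[R]_d) = 0.
Proof. by rewrite /norm1 big1// => i _; rewrite mxE normr0. Qed.

Lemma norm1D d (x y : 'rV[R]_d) : norm1 (x + y) <= norm1 x + norm1 y.
Proof.
by rewrite -big_split; apply: ler_sum => i _; rewrite mxE ler_normD.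
Qed.

Lemma norm1Z d a (x : 'rV[R]_d) : norm1 (a *: x) = `|a| * norm1 x.
Proof. by rewrite mulr_sumr; apply: eq_bigr => i _; rewrite mxE normrM. Qed.

Lemma norm1N d (x : 'rV[R]_d) : norm1 (- x) = norm1 x.
Proof. by apply: eq_bigr => i _; rewrite mxE normrN. Qed.

Lemma norm1_dist d (x y : 'rV[R]_d) : `|norm1 x - norm1 y| <= norm1 (x - y).
Proof.
rewrite ler_norml; apply/andP; split.
  by rewrite lerNl opprB lerBlDr -(norm1N (x - y)) opprB -{1}(subrK x y) norm1D.
by rewrite lerBlDr -{1}(subrK y x) norm1D.
Qed.

Lemma enorm_le_norm1 d (x : 'rV[R]_d) : enorm x <= norm1 x.
Proof.
rewrite -(@ler_pXn2r _ 2)// ?nnegrE ?enorm_ge0 ?norm1_ge0//.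
elim: d x => [|d IH] x.
  by rewrite enorm_sqr /dotv big_ord0 sqr_ge0.
rewrite -(row_consK x) enorm_sqr dotv_row_cons -enorm_sqr norm1_row_cons.
apply: le_trans (lerD (lexx _) (IH _)) _.
rewrite sqrrD real_normK ?num_real// -expr2 lerD2r lerDl.
by rewrite mulrn_wge0// mulr_ge0// norm1_ge0.
Qed.

(** Link with the sup norm, in which differentiability is expressed. *)
Lemma norm1_le_norm d (x : 'rV[R]_d) : norm1 x <= d%:R * `|x|.
Proof.
apply: (@le_trans _ _ (\sum_(i < d) `|x|)); last by rewrite sumr_const card_ord mulr_natl.
apply: ler_sum => i _; rewrite [leRHS]/Num.norm/= mx_normrE.
exact: (le_bigmax _ (fun ij => `|x ij.1 ij.2|) (ord0, i)).
Qed.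

End NormOne.

(** * Linearity, monotonicity and stability of iterated expectations *)

Section GaussExp.
Context {R : realType}.
Local Notation N01 := (@normal_prob R 0 1).
Local Notation E1 g := (Rintegral N01 [set: R] g).
Local Notation tame1 := (@tame R R (fun t : R => `|t|)).
Local Notation tamed d := (@tame R 'rV[R]_d (@norm1 R d)).
Implicit Types (d : nat).

Lemma gauss_expS d (g : 'rV[R]_d.+1 -> R) :
  gauss_exp g = E1 (fun t => gauss_exp (fun v => g (row_cons t v))).
Proof. by []. Qed.

Lemma tame_slice d (g : 'rV[R]_d.+1 -> R) t : tamed d.+1 g ->
  tamed d (fun v => g (row_cons t v)).
Proof.
move=> [C [k [C0 k0 [h1 h2]]]].
exists (C * expR (k * (`|t| + `|t|))), k; split; rewrite ?mulr_ge0//.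
split=> [v|v w].
  apply: le_trans (h1 _) _; rewrite -mulrA ler_wpM2l// -expRD ler_expR -mulrDr.
  by rewrite ler_wpM2l// norm1_row_cons lerD2r lerDl.
apply: le_trans (h2 _ _) _; rewrite -row_consN -row_consD subrr !norm1_row_cons normr0 add0r.
rewrite ler_wpM2r ?norm1_ge0// -mulrA ler_wpM2l// -expRD ler_expR -mulrDr ler_wpM2l//.
by rewrite addrACA.
Qed.

Lemma tame_expR_norm1 d (k : R) : 0 <= k -> tamed d (fun v => expR (k * norm1 v)).
Proof.
move=> k0; apply: (@tame_expR _ _ _ (@norm1_ge0 R d) (norm10 d) 0 k) => // [x|x y].
  by rewrite add0r.
by rewrite -mulrBr normrM ger0_norm// ler_wpM2l// norm1_dist.
Qed.

(* Linearity and monotonicity on slices make the marginal [t |-> E g(t, .)] tame, which is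
   what the induction on the dimension needs. *)
Lemma tame_marginal_aux d (g : 'rV[R]_d.+1 -> R) :
  (forall a (f g : 'rV[R]_d -> R), tamed d f -> tamed d g ->
    gauss_exp (fun v => a * f v + g v) = a * gauss_exp f + gauss_exp g) ->
  (forall f g : 'rV[R]_d -> R, tamed d f -> tamed d g -> (forall v, f v <= g v) ->
    gauss_exp f <= gauss_exp g) ->
  tamed d.+1 g -> tame1 (fun t => gauss_exp (fun v => g (row_cons t v))).
Proof.
move=> lin mono tg; have sl t := tame_slice t tg.
have [C [k [C0 k0 [h1 h2]]]] := tg.
have n1 := @norm1_ge0 R d.
have t0 : tamed d (fun=> 0) by exact: tame_cst.
have lin0 a (f : 'rV[R]_d -> R) : tamed d f ->
    gauss_exp (fun v => a * f v) = a * gauss_exp f.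
  have z : gauss_exp (fun _ : 'rV[R]_d => 0) = 0.
    have := lin 1 _ _ t0 t0; rewrite (_ : (fun _ => _) = fun=> 0); first by lra.
    by apply/funext => v; rewrite mulr0 addr0.
  move=> tf; have := lin a _ _ tf t0; rewrite z addr0 => <-.
  by congr gauss_exp; apply/funext => v; rewrite addr0.
have bnd (f e : 'rV[R]_d -> R) : tamed d f -> tamed d e ->
    (forall v, `|f v| <= e v) -> `|gauss_exp f| <= gauss_exp e.
  move=> tf te fe; rewrite ler_norml; apply/andP; split.
    rewrite -[X in X <= _]mulN1r -lin0//; apply: mono => //.
      exact: tameZ.
    by move=> v; have := fe v; rewrite ler_norml mulN1r => /andP[].
  by apply: mono => // v; apply: le_trans (ler_norm _) (fe v).
(* Exponential moments of the remaining coordinates: [M k] serves the growth bound, [M (k + k)] the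
   Lipschitz bound, where both points share the same [v]. *)
pose M (j : R) := gauss_exp (fun v : 'rV[R]_d => expR (j * norm1 v)).
have te j : 0 <= j -> tamed d (fun v => expR (j * norm1 v)) := @tame_expR_norm1 d j.
have k20 : 0 <= k + k by rewrite addr_ge0.
have M0 j : 0 <= j -> 0 <= M j.
  move=> j0; apply: le_trans (normr_ge0 (gauss_exp (fun _ : 'rV[R]_d => 0))) _.
  by apply: bnd => //; [exact: te|move=> v; rewrite normr0].
exists (C * (M k + M (k + k))), k; split; rewrite ?mulr_ge0 ?addr_ge0 ?M0//.
split=> [t|t s].
  apply: (@le_trans _ _ (C * expR (k * `|t|) * M k)).
    rewrite -lin0; last exact: te.
    apply: bnd => //; first by apply: tameZ => //; exact: te.
    by move=> v; apply: le_trans (h1 _) _; rewrite norm1_row_cons -mulrA -expRD mulrDr.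
  by rewrite mulrAC ler_wpM2r// ler_wpM2l// lerDl M0.
have -> : gauss_exp (fun v => g (row_cons t v)) - gauss_exp (fun v => g (row_cons s v)) =
    gauss_exp (fun v => -1 * g (row_cons s v) + g (row_cons t v)).
  by rewrite lin// mulN1r addrC.
apply: (@le_trans _ _ (C * expR (k * (`|t| + `|s|)) * `|t - s| * M (k + k))).
  rewrite -lin0; last exact: te.
  apply: bnd => //; first by apply: tameD => //; apply: tameZ.
    by apply: tameZ => //; exact: te.
  move=> v; rewrite mulN1r addrC; apply: le_trans (h2 _ _) _.
  rewrite -row_consN -row_consD subrr !norm1_row_cons norm10 addr0.
  rewrite [leRHS]mulrAC ler_wpM2r// -mulrA -expRD ler_wpM2l// ler_expR mulrDl -!mulrDr.
  by rewrite ler_wpM2l// addrACA.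
rewrite mulrAC ler_wpM2r// mulrAC ler_wpM2r// ler_wpM2l// lerDr; exact: M0.
Qed.

(** Both properties go through one induction, since tameness of the marginals rests on both in the
    lower dimension. *)
Lemma gauss_exp_lin_le d :
  (forall a (f g : 'rV[R]_d -> R), tamed d f -> tamed d g ->
    gauss_exp (fun v => a * f v + g v) = a * gauss_exp f + gauss_exp g) /\
  (forall f g : 'rV[R]_d -> R, tamed d f -> tamed d g -> (forall v, f v <= g v) ->
    gauss_exp f <= gauss_exp g).
Proof.
elim: d => [|d [lin mono]]; first by split=> [a f g _ _|f g _ _ h] //=.
have mt g := @tame_marginal_aux d g lin mono.
split=> [a f g tf tg|f g tf tg fg]; rewrite !gauss_expS.
  rewrite -E1_lin; [|exact: mt|exact: mt].
  by apply: eq_Rintegral => t _; apply: lin; exact: tame_slice.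
apply: E1_le; [exact: mt|by apply: tame1_integrable; exact: mt|].
by move=> t; apply: mono => //; exact: tame_slice.
Qed.

Lemma gauss_exp_lin d a (f g : 'rV[R]_d -> R) : tamed d f -> tamed d g ->
  gauss_exp (fun v => a * f v + g v) = a * gauss_exp f + gauss_exp g.
Proof. exact: (gauss_exp_lin_le d).1. Qed.

Lemma gauss_exp_le d (f g : 'rV[R]_d -> R) : tamed d f -> tamed d g ->
  (forall v, f v <= g v) -> gauss_exp f <= gauss_exp g.
Proof. exact: (gauss_exp_lin_le d).2. Qed.

Lemma tame_marginal d (g : 'rV[R]_d.+1 -> R) : tamed d.+1 g ->
  tame1 (fun t => gauss_exp (fun v => g (row_cons t v))).
Proof. by have [l m] := gauss_exp_lin_le d; exact: tame_marginal_aux. Qed.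

Lemma gauss_exp_cst d (c : R) : gauss_exp (fun _ : 'rV[R]_d => c) = c.
Proof.
elim: d => [|d IH] //; rewrite gauss_expS -[RHS]E1_cst.
by apply: eq_Rintegral => t _; exact: IH.
Qed.

Lemma gauss_expZ d a (f : 'rV[R]_d -> R) : tamed d f ->
  gauss_exp (fun v => a * f v) = a * gauss_exp f.
Proof.
move=> tf; have := @gauss_exp_lin d a f (fun=> 0) tf (tame_cst (@norm1_ge0 R d) 0).
rewrite gauss_exp_cst addr0 => <-.
by congr gauss_exp; apply/funext => v; rewrite addr0.
Qed.

Lemma gauss_expD d (f g : 'rV[R]_d -> R) : tamed d f -> tamed d g ->
  gauss_exp (fun v => f v + g v) = gauss_exp f + gauss_exp g.
Proof.
move=> tf tg; rewrite -[gauss_exp f]mul1r -gauss_exp_lin//.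
by congr gauss_exp; apply/funext => v; rewrite mul1r.
Qed.

Lemma gauss_expB d (f g : 'rV[R]_d -> R) : tamed d f -> tamed d g ->
  gauss_exp (fun v => f v - g v) = gauss_exp f - gauss_exp g.
Proof.
move=> tf tg; rewrite [RHS]addrC -[- _]mulN1r -gauss_exp_lin//.
by congr gauss_exp; apply/funext => v; rewrite mulN1r addrC.
Qed.

Lemma gauss_exp_norm_le d (f g : 'rV[R]_d -> R) : tamed d f -> tamed d g ->
  (forall v, `|f v| <= g v) -> `|gauss_exp f| <= gauss_exp g.
Proof.
move=> tf tg fg; rewrite ler_norml -mulN1r -gauss_expZ//; apply/andP; split.
  apply: gauss_exp_le => //; first by apply: tameZ => //; exact: norm1_ge0.
  by move=> v; have := fg v; rewrite ler_norml mulN1r => /andP[].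
by apply: gauss_exp_le => // v; apply: le_trans (ler_norm _) (fg v).
Qed.

Lemma gauss_exp_sum d (I : finType) (F : I -> 'rV[R]_d -> R) :
  (forall i, tamed d (F i)) ->
  gauss_exp (fun v => \sum_i F i v) = \sum_i gauss_exp (F i).
Proof.
move=> tF; rewrite (_ : (fun v => _) = \sum_i F i); last first.
  by apply/funext => v; rewrite fct_sumE.
suff [] : tamed d (\sum_i F i) /\ gauss_exp (\sum_i F i) = \sum_i gauss_exp (F i) by [].
elim/big_ind2 : _ => [|f a g b [tf <-] [tg <-]|i _]; last by split.
  split; [apply: tame_cst; exact: norm1_ge0|exact: gauss_exp_cst].
by split; [apply: tameD => //; exact: norm1_ge0|rewrite -gauss_expD].
Qed.

Lemma tame_affine d (g : 'rV[R]_d -> R) (x : 'rV[R]_d) (s : R) : tamed d g ->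
  tamed d (fun u => g (x + s *: u)).
Proof.
move=> [C [k [C0 k0 [h1 h2]]]].
have nx := norm1_ge0 x.
have naff u : norm1 (x + s *: u) <= norm1 x + `|s| * norm1 u.
  by rewrite -norm1Z norm1D.
exists (C * expR (k * (norm1 x + norm1 x)) * (1 + `|s|)), (k * `|s|).
split; rewrite ?mulr_ge0 ?addr_ge0//; split=> [u|u v].
  apply: le_trans (h1 _) _.
  apply: (@le_trans _ _ (C * expR (k * (norm1 x + norm1 x)) * expR (k * `|s| * norm1 u))).
    rewrite -mulrA -expRD ler_wpM2l// ler_expR -mulrA -mulrDr ler_wpM2l//.
    by have := naff u; lra.
  by rewrite ler_wpM2r// ler_peMr ?mulr_ge0// lerDl.
apply: le_trans (h2 _ _) _; rewrite opprD addrACA subrr add0r -scalerBr norm1Z.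
apply: (@le_trans _ _ (C * expR (k * (norm1 x + norm1 x)) *
   expR (k * `|s| * (norm1 u + norm1 v)) * (`|s| * norm1 (u - v)))).
  rewrite ler_wpM2r ?mulr_ge0 ?norm1_ge0// -(mulrA C) -expRD ler_wpM2l// ler_expR.
  rewrite -mulrA -mulrDr ler_wpM2l//.
  by have := naff u; have := naff v; lra.
rewrite mulrA ler_wpM2r ?norm1_ge0// [leRHS]mulrAC ler_wpM2l ?mulr_ge0//.
by rewrite lerDr.
Qed.

End GaussExp.

(** * Gaussian shifts and their second-order expansion *)

Section Tilt.
Context {R : realType}.
Local Notation N01 := (@normal_prob R 0 1).
Local Notation E1 g := (Rintegral N01 [set: R] g).
Local Notation tamed d := (@tame R 'rV[R]_d (@norm1 R d)).
Implicit Types (d : nat).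

(** Density of the normal law with mean [b] and identity covariance relative to the standard one. *)
Definition tilt d (b u : 'rV[R]_d) : R := expR (dotv b u - dotv b b / 2).

Lemma dotvv_ge0 d (b : 'rV[R]_d) : 0 <= dotv b b.
Proof. by rewrite -enorm_sqr sqr_ge0. Qed.

Lemma normr_dotv_norm1 d (b u : 'rV[R]_d) : `|dotv b u| <= enorm b * norm1 u.
Proof.
apply: le_trans (normr_dotv_le _ _) _.
by rewrite ler_wpM2l ?enorm_ge0// enorm_le_norm1.
Qed.

Lemma tame_dotv d (b : 'rV[R]_d) : tamed d (dotv b).
Proof.
apply: (@tame_lip _ _ _ (@norm1_ge0 R d) (norm10 d) (enorm b)); first exact: enorm_ge0.
by move=> x y; rewrite -dotvNr -dotvDr normr_dotv_norm1.
Qed.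

Lemma tame_coord d (i : 'I_d) : tamed d (fun u => u ord0 i).
Proof.
apply: (@tame_lip _ _ _ (@norm1_ge0 R d) (norm10 d) 1) => // x y.
rewrite mul1r; apply: le_trans (enorm_le_norm1 _).
by have := enorm_coord (x - y) i; rewrite !mxE.
Qed.

Lemma tame_enorm d : tamed d (@enorm R d).
Proof.
apply: (@tame_lip _ _ _ (@norm1_ge0 R d) (norm10 d) 1) => // x y.
rewrite mul1r; apply: le_trans (enorm_le_norm1 _).
rewrite ler_norml; apply/andP; split; last exact: enorm_sub_le.
by rewrite lerNl opprB enormBC enorm_sub_le.
Qed.

Lemma tame_norm1 d : tamed d (@norm1 R d).
Proof.
apply: (@tame_lip _ _ _ (@norm1_ge0 R d) (norm10 d) 1) => // x y.
by rewrite mul1r norm1_dist.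
Qed.

Lemma tame_tilt d (b : 'rV[R]_d) : tamed d (tilt b).
Proof.
apply: (@tame_expR _ _ _ (@norm1_ge0 R d) (norm10 d) 0 (enorm b)); first exact: enorm_ge0.
  move=> x; rewrite add0r; apply: le_trans (normr_dotv_norm1 _ _).
  by have := ler_norm (dotv b x); have := dotvv_ge0 b; lra.
by move=> x y; rewrite opprB addrA subrK -dotvNr -dotvDr normr_dotv_norm1.
Qed.

Lemma tilt_row_cons d a t (b v : 'rV[R]_d) :
  tilt (row_cons a b) (row_cons t v) = expR (a * t - a ^+ 2 / 2) * tilt b v.
Proof. by rewrite /tilt !dotv_row_cons -expRD; congr expR; rewrite expr2; lra. Qed.

(* Cameron-Martin formula *)
Lemma gauss_exp_shift d (g : 'rV[R]_d -> R) (b : 'rV[R]_d) : tamed d g ->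
  gauss_exp (fun u => g (u + b)) = gauss_exp (fun u => g u * tilt b u).
Proof.
elim: d g b => [|d IH] g b tg.
  by rewrite /= /tilt (thinmx0 b) addr0 /dotv !big_ord0 mul0r subrr expR0 mulr1.
rewrite -(row_consK b); set a := b ord0 ord0; set b' := row_tail b.
(* Marginal with the tail already shifted: the one-dimensional formula treats the first coordinate,
   the induction hypothesis the tail. *)
pose G t := gauss_exp (fun v => g (row_cons t (v + b'))).
have tG : tame (fun t : R => `|t|) G.
  have := tame_marginal (tame_affine (row_cons 0 b') 1 tg).
  congr (tame _ _); apply/funext => t; congr gauss_exp; apply/funext => v.
  by rewrite scale1r -row_consD add0r addrC.
rewrite !gauss_expS; transitivity (E1 (fun t => G (t + a))).
  by apply: eq_Rintegral => t _; congr gauss_exp; apply/funext => v; rewrite -row_consD.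
rewrite E1_shift//; apply: eq_Rintegral => t _.
rewrite /G (IH (fun v => g (row_cons t v))); last exact: tame_slice.
rewrite mulrC -gauss_expZ; last first.
  apply: tameM; [exact: norm1_ge0|exact: tame_slice|exact: tame_tilt].
by congr gauss_exp; apply/funext => v; rewrite tilt_row_cons; ring.
Qed.

(** Only [1 + p <= e^p] is used, at [p] and [- p]: it gives [0 <= e^p - 1 - p <= p (e^p - 1)]. *)
Lemma expR_second_order (p : R) : `|expR p - 1 - p| <= p ^+ 2 * expR `|p|.
Proof.
have h0 := expR_ge1Dx p; rewrite ger0_norm; last by lra.
have h1 : expR p - 1 <= p * expR p.
  have := expR_ge1Dx (- p); rewrite -(ler_pM2l (expR_gt0 p)) -expRD subrr expR0; lra.
have [p0|p0] := leP 0 p.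
  rewrite ger0_norm//; apply: (@le_trans _ _ (p * (expR p - 1))); first by lra.
  by rewrite expr2 -mulrA ler_wpM2l.
apply: (@le_trans _ _ (- p * (- p))).
  apply: (@le_trans _ _ (- p * (1 - expR p))); first by lra.
  by rewrite ler_wpM2l//; lra.
rewrite mulrNN -expr2 ler_peMr ?sqr_ge0// -expR0 ler_expR//.
Qed.

(** The error splits into the normalising factor and the Taylor remainder of the exponential. As
    [|b| <= 1], both are bounded by [|b|^2] times a tame weight independent of [b]. *)
Lemma tilt_second_order d (b u : 'rV[R]_d) : enorm b <= 1 ->
  `|tilt b u - 1 - dotv b u| <= enorm b ^+ 2 * ((1 + norm1 u ^+ 2) * expR (norm1 u)).
Proof.
move=> b1; have pN := normr_dotv_norm1 b u; have N0 := norm1_ge0 u.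
have pN1 : `|dotv b u| <= norm1 u.
  by apply: le_trans pN _; rewrite ler_piMl.
rewrite (_ : tilt b u - 1 - dotv b u =
  (tilt b u - expR (dotv b u)) + (expR (dotv b u) - 1 - dotv b u)); last by ring.
apply: le_trans (ler_normD _ _) _; rewrite [in leRHS]mulrDl mulrDr; apply: lerD.
  have b0 := dotvv_ge0 b; have uN := le_trans (ler_norm (dotv b u)) pN1.
  apply: le_trans (@normr_expRB _ _ _ (norm1 u) _ _) _ => //; first by lra.
  rewrite mul1r mulrC ler_wpM2r// addrAC subrr add0r normrN enorm_sqr ger0_norm; lra.
apply: le_trans (expR_second_order _) _; rewrite mulrA; apply: ler_pM; rewrite ?sqr_ge0//.
  by rewrite -exprMn -[leLHS]real_normK ?num_real// lerXn2r ?nnegrE ?mulr_ge0 ?enorm_ge0.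
by rewrite ler_expR.
Qed.

(** After Cameron-Martin the increment sits on the smooth weight, so a merely locally Lipschitz [g]
    still has a second-order expansion. *)
Lemma gauss_exp_shift_second_order d (g : 'rV[R]_d -> R) : tamed d g ->
  exists2 K : R, 0 <= K & forall b, enorm b <= 1 ->
    `|gauss_exp (fun u => g (u + b)) - gauss_exp g -
      gauss_exp (fun u => dotv b u * g u)| <= K * enorm b ^+ 2.
Proof.
move=> tg; have n0 := @norm1_ge0 R d.
pose W (u : 'rV[R]_d) := (1 + norm1 u ^+ 2) * expR (norm1 u).
have tW : tamed d W.
  apply: tameM => //.
    apply: tameD => //; first exact: tame_cst.
    exact: (tameX n0 2 (@tame_norm1 d)).
  by have := @tame_expR_norm1 R d 1 ler01; congr (tame _ _);
    apply/funext => u; rewrite mul1r.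
have tgW : tamed d (fun u => `|g u| * W u) by apply: tameM => //; exact: tame_norm.
exists (gauss_exp (fun u => `|g u| * W u)).
  rewrite -(gauss_exp_cst d 0); apply: gauss_exp_le => //; first exact: tame_cst.
  by move=> u; rewrite !mulr_ge0// addr_ge0// sqr_ge0.
move=> b b1.
have tt : tamed d (fun u => g u * tilt b u) by apply: tameM => //; exact: tame_tilt.
have td : tamed d (fun u => dotv b u * g u) by apply: tameM => //; exact: tame_dotv.
rewrite gauss_exp_shift// -gauss_expB// -gauss_expB//; last exact: tameB.
rewrite mulrC -gauss_expZ//; apply: gauss_exp_norm_le.
- by do 2 apply: tameB => //.
- exact: tameZ.
move=> u; rewrite (_ : _ - _ = g u * (tilt b u - 1 - dotv b u)); last by ring.
rewrite normrM mulrCA ler_wpM2l//; exact: tilt_second_order.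
Qed.

(** * Moments of the Gaussian norm *)

(** The majorant is a product over the coordinates, and integrating each one contributes a factor
    [(1 - lam)^(-1/2)]. Only [g] has to be tame. *)
Lemma gauss_exp_expR_sqr_le d (g : 'rV[R]_d -> R) (K lam : R) : lam < 1 -> tamed d g ->
  (forall u, g u <= K * expR (lam * dotv u u / 2)) ->
  gauss_exp g <= K * (Num.sqrt (1 - lam))^-1 ^+ d.
Proof.
move=> lam1; elim: d g K => [|d IH] g K tg h.
  by have := h 0; rewrite /dotv big_ord0 mulr0 mul0r expR0 expr0 !mulr1.
rewrite gauss_expS; set c := (Num.sqrt _)^-1.
apply: (@le_trans _ _ (E1 (fun t => (K * c ^+ d) * expR (lam * t ^+ 2 / 2)))).
  apply: E1_le; first exact: tame_marginal.
    exact: (integrableZl measurableT (K * c ^+ d) (integrable_expR_sqr lam1)).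
  move=> t; rewrite mulrAC; apply: IH; first exact: tame_slice.
  move=> v; apply: le_trans (h _) _; rewrite dotv_row_cons -expr2.
  by rewrite mulrDr mulrDl expRD mulrA.
rewrite RintegralZl//; last exact: integrable_expR_sqr.
by rewrite E1_expR_sqr// -/c exprSr mulrA.
Qed.

Lemma gauss_exp_enorm_sqr_le d : gauss_exp (fun u : 'rV[R]_d => enorm u ^+ 2) <= d%:R.
Proof.
elim: d => [|d IH]; first by rewrite /= enorm_sqr /dotv big_ord0.
have tn e : tamed e (fun u => enorm u ^+ 2).
  exact: (tameX (@norm1_ge0 R e) 2 (@tame_enorm e)).
rewrite gauss_expS; set c := gauss_exp _ in IH *.
have tt : tame (fun t : R => `|t|) (fun t : R => t ^+ 2).
  exact: (tameX (@normr_ge0 _ _) 2 tame1_id).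
have tc : tame (fun t : R => `|t|) (fun=> c) by apply: tame_cst; exact: normr_ge0.
rewrite (_ : Rintegral _ _ _ = 1 * E1 (fun t => t ^+ 2) + E1 (fun=> c)).
  by rewrite mul1r E1_cst -natr1 addrC; apply: lerD => //; exact: E1_sqr_le1.
rewrite -(E1_lin 1 tt tc); apply: eq_Rintegral => t _.
rewrite mul1r -[t ^+ 2](gauss_exp_cst d) /c -gauss_expD//; last first.
  by apply: tame_cst; exact: norm1_ge0.
by congr gauss_exp; apply/funext => v; rewrite !enorm_sqr dotv_row_cons expr2.
Qed.

(** Takes expectations in [|u| <= |u|^2 / (2 s) + s / 2] with [s = sqrt d]; dimension 0 is apart
    because [s] vanishes. *)
Lemma gauss_exp_enorm_le d : gauss_exp (@enorm R d) <= Num.sqrt d%:R.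
Proof.
case: d => [|d]; first by rewrite /= enorm0 sqrtr_ge0.
set s := Num.sqrt _; have s0 : 0 < s by rewrite sqrtr_gt0 ltr0n.
have n0 := @norm1_ge0 R d.+1.
have tn : tamed d.+1 (fun u => enorm u ^+ 2) by exact: (tameX n0 2 (@tame_enorm _)).
apply: (@le_trans _ _ (gauss_exp (fun u : 'rV[R]_d.+1 => (2 * s)^-1 * enorm u ^+ 2 + s / 2))).
  apply: gauss_exp_le; first exact: tame_enorm.
    by apply: tameD => //; [exact: tameZ|exact: tame_cst].
  move=> u; rewrite -(ler_pM2l s0) mulrDr.
  rewrite [X in X + _](_ : _ = enorm u ^+ 2 / 2); last by field; rewrite gt_eqF.
  by have := sqr_ge0 (enorm u - s); lra.
rewrite gauss_exp_lin//; last exact: tame_cst.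
rewrite gauss_exp_cst.
have h : (2 * s)^-1 * gauss_exp (fun u : 'rV[R]_d.+1 => enorm u ^+ 2) <= s / 2.
  apply: (@le_trans _ _ ((2 * s)^-1 * s ^+ 2)).
    rewrite ler_wpM2l ?invr_ge0 ?mulr_ge0 ?(ltW s0)// sqr_sqrtr ?ler0n//.
    exact: gauss_exp_enorm_sqr_le.
  by rewrite le_eqVlt; apply/orP; left; apply/eqP; field; rewrite gt_eqF.
lra.
Qed.

(* With [n = p + d], [z = x / sqrt n] and [z <= e^((z^2 - 1) / 2)], one has
   [x^p <= n^(p/2) e^(-p/2) e^(lam x^2 / 2)] for [lam = p / n], while
   [(1 - lam)^(-d/2) = (1 + p / d)^(d/2) <= e^(p/2)]. *)
Lemma gauss_exp_enormX_le d p :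
  gauss_exp (fun u : 'rV[R]_d => enorm u ^+ p) <= (p + d)%:R `^ (p%:R / 2).
Proof.
(* For [p = d = 0] the right-hand side is the power [0^0], equal to 1. *)
case: p => [|p].
  rewrite mul0r powRr0; under [X in gauss_exp X]funext do rewrite expr0.
  by rewrite gauss_exp_cst.
case: d => [|d]; first by rewrite /= enorm0 expr0n/= powR_ge0.
set n : R := (p.+1 + d.+1)%:R; have n0 : 0 < n by rewrite ltr0n.
set s := Num.sqrt n; have s0 : 0 < s by rewrite sqrtr_gt0.
have s2 : s ^+ 2 = n by rewrite sqr_sqrtr// ltW.
rewrite (_ : n `^ _ = s ^+ p.+1); last first.
  by rewrite mulrC powRrM powR12_sqrt ?(ltW n0)// powR_mulrn ?(ltW s0).
pose lam := p.+1%:R / n.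
have nE : n = p.+1%:R + d.+1%:R by rewrite -natrD.
have d0 : 0 < d.+1%:R :> R by rewrite ltr0n.
have lam1 : lam < 1 by rewrite ltr_pdivrMr// mul1r nE ltrDl.
have := @gauss_exp_expR_sqr_le d.+1 (fun u => enorm u ^+ p.+1)
  (s ^+ p.+1 * expR (- (p.+1%:R / 2))) lam lam1
  (tameX (@norm1_ge0 R d.+1) p.+1 (@tame_enorm _)).
move=> H; apply: le_trans (H _) _.
  move=> u; rewrite -enorm_sqr -[leRHS]mulrA -expRD.
  set x := enorm u; have x0 : 0 <= x by exact: enorm_ge0.
  pose z := x / s; have z0 : 0 <= z by rewrite divr_ge0// ltW.
  have xE : x = s * z by rewrite mulrC divfK// gt_eqF.
  have zle : z <= expR ((z ^+ 2 - 1) / 2).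
    rewrite -(@ler_pXn2r _ 2)// ?nnegrE ?expR_ge0// -expRM_natr divfK//.
    by have := expR_ge1Dx (z ^+ 2 - 1); lra.
  rewrite xE exprMn ler_pM2l ?exprn_gt0//.
  rewrite (_ : expR _ = expR ((z ^+ 2 - 1) / 2) ^+ p.+1).
    by rewrite lerXn2r ?nnegrE ?expR_ge0.
  rewrite -expRM_natr; congr expR; rewrite exprMn s2 /lam; field.
  by rewrite gt_eqF.
rewrite -mulrA ler_piMr ?exprn_ge0 ?(ltW s0)//.
set c := (Num.sqrt _)^-1.
have cle : c <= expR (p.+1%:R / d.+1%:R / 2).
  have lE : 1 - lam = d.+1%:R / n.
    have dE : d.+1%:R = n - p.+1%:R by rewrite nE addrAC subrr add0r.
    by rewrite dE /lam; field; rewrite gt_eqF.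
  rewrite -(@ler_pXn2r _ 2)// ?nnegrE ?expR_ge0 ?invr_ge0 ?sqrtr_ge0//.
  rewrite -expRM_natr divfK// exprVn sqr_sqrtr ?subr_ge0 ?(ltW lam1)// lE.
  apply: le_trans (expR_ge1Dx _); rewrite invf_div nE.
  by rewrite le_eqVlt; apply/orP; left; apply/eqP; field; rewrite gt_eqF.
have cd : c ^+ d.+1 <= expR (p.+1%:R / 2).
  rewrite (_ : expR _ = expR (p.+1%:R / d.+1%:R / 2) ^+ d.+1).
    by rewrite lerXn2r ?nnegrE ?expR_ge0 ?invr_ge0 ?sqrtr_ge0.
  by rewrite -expRM_natr; congr expR; field; rewrite gt_eqF.
apply: le_trans (ler_wpM2l (expR_ge0 _) cd) _.
by rewrite -expRD addNr expR0.
Qed.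

End Tilt.

(** * Gaussian smoothing *)

(** A quadratic remainder is negligible against the sup norm, so [dotv a] is the differential by
    uniqueness; its values on the basis vectors are the partial derivatives. *)
Lemma quadratic_error_grad {R : realType} {d : nat} (g : 'rV[R]_d -> R)
    (x a : 'rV[R]_d) (K r : R) : 0 <= K -> 0 < r ->
  (forall h, enorm h <= r -> `|g (x + h) - g x - dotv a h| <= K * enorm h ^+ 2) ->
  differentiable g x /\ grad g x = a.
Proof.
move=> K0 r0 hg.
have lin : linear (dotv a : 'rV[R]_d -> R).
  by move=> c u v; rewrite dotvDr dotvZr.
pose df : {linear 'rV[R]_d -> R} := HB.pack (dotv a : 'rV[R]_d -> R)
  (GRing.isLinear.Build _ _ _ _ _ lin).
have cdf : continuous df.
  move=> y; apply: differentiable_continuous.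
  rewrite (_ : (df : _ -> _) = \sum_i (fun z : 'rV[R]_d => a ord0 i *: z ord0 i)); last first.
    by apply/funext => z; rewrite fct_sumE.
  apply: differentiable_sum => i; apply: differentiableZ; exact: differentiable_coord.
have expansion e : 0 < e ->
    \forall h \near (0 : 'rV[R]_d), `|g (h + x) - (g x + dotv a h)| <= e * `|h|.
  move=> e0.
  (* The added 1 keeps [D] positive in dimension 0. *)
  pose D : R := d%:R + 1.
  have D0 : 0 < D by rewrite ltr_wpDl.
  near=> h.
  have hD : enorm h <= D * `|h|.
    apply: le_trans (enorm_le_norm1 _) _; apply: le_trans (norm1_le_norm _) _.
    by rewrite ler_wpM2r// lerDl.
  have hr : `|h| <= r / D.
    near: h; rewrite /=; apply: cvgr0_norm_le; [exact: cvg_id|exact: divr_gt0].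
  have he : `|h| <= e / (K * D ^+ 2 + 1).
    near: h; apply: cvgr0_norm_le; first exact: cvg_id.
    by rewrite divr_gt0// ltr_wpDl// mulr_ge0// exprn_ge0// ltW.
  rewrite (addrC h) opprD addrA.
  apply: le_trans (hg h _) _.
    by apply: le_trans hD _; rewrite mulrC -ler_pdivlMr.
  apply: (@le_trans _ _ (K * (D * `|h|) ^+ 2)).
    by rewrite ler_wpM2l// lerXn2r ?nnegrE ?enorm_ge0// mulr_ge0// ltW.
  rewrite exprMn [_ * (_ * _)](_ : _ = (K * D ^+ 2 * `|h|) * `|h|); last by ring.
  rewrite ler_wpM2r//; move: he; rewrite ler_pdivlMr ?ltr_wpDl ?mulr_ge0 ?exprn_ge0 ?(ltW D0)//.
  by rewrite mulrDr mulr1 mulrC; have := normr_ge0 h; lra.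
have dE : 'd g x = df :> ('rV[R]_d -> R).
  by apply: diff_unique => //; apply/eqaddoP => e; exact: expansion.
have dg : differentiable g x.
  by apply/diff_locallyP; rewrite dE; split=> //; apply/eqaddoP => e; exact: expansion.
split=> //; apply/rowP => i; rewrite mxE /partial deriveE// dE /=.
rewrite /dotv (bigD1 i)//= big1 ?addr0; last first.
  by move=> j ji; rewrite mxE eqxx (negbTE ji) mulr0.
by rewrite mxE !eqxx mulr1.
Unshelve. all: by end_near. Qed.

(** Convexity of the power with the sharp constant, needed for the stated coefficients. The
    induction uses [(a - b) (a^(n+1) - b^(n+1)) >= 0]. *)
Lemma exprSD_le {R : realType} (a b : R) (n : nat) : 0 <= a -> 0 <= b ->
  (a + b) ^+ n.+1 <= 2 ^+ n * (a ^+ n.+1 + b ^+ n.+1).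
Proof.
move=> a0 b0; elim: n => [|n IH]; first by rewrite expr0 mul1r !expr1.
rewrite exprS; apply: le_trans (ler_wpM2l (addr_ge0 a0 b0) IH) _.
rewrite mulrCA [2 ^+ n.+1]exprSr -mulrA ler_wpM2l ?exprn_ge0//.
have : 0 <= (a - b) * (a ^+ n.+1 - b ^+ n.+1).
  have [ab|/ltW ab] := leP a b.
    by apply: mulr_le0; rewrite subr_le0// lerXn2r.
  by apply: mulr_ge0; rewrite subr_ge0// lerXn2r.
by rewrite !(exprS _ n.+1); lra.
Qed.

(** * Lipschitz bounds for the smoothed function and its gradient *)

Section Smoothing.
Context {R : realType} {d : nat}.
Variables (f : 'rV[R]_d -> R) (R1 R2 : R) (m : nat) (sigma : R).
Hypotheses (spb : SPB_with f R1 R2 m) (sigma_gt0 : 0 < sigma).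
Local Notation tamed := (@tame R 'rV[R]_d (@norm1 R d)).
Local Notation fs := (gsmooth f sigma).
Implicit Types (x y u w : 'rV[R]_d).

Let R1_ge0 : 0 <= R1. Proof. by case: spb. Qed.
Let R2_ge0 : 0 <= R2. Proof. by case: spb => _ /ltW. Qed.
Let n0 := @norm1_ge0 R d.

(** With [S = |x|_1 + |y|_1], one has [|x| + |y - x| <= 2 S <= 2 e^S], so the [m]-th power is at
    most [2^m e^(m S)]. *)
Lemma tame_SPB : tamed f.
Proof.
apply: (@tame_loclip _ _ _ n0 (norm10 d) (R1 * 2 ^+ m + R2) m%:R) => //.
  by rewrite addr_ge0// mulr_ge0// exprn_ge0.
move=> x y; apply: le_trans (SPB_lipschitz x y spb) _.
have S0 : 0 <= norm1 x + norm1 y by rewrite addr_ge0.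
apply: ler_pM; rewrite ?enorm_ge0 ?enorm_le_norm1//.
  by rewrite addr_ge0// mulr_ge0// exprn_ge0// addr_ge0 ?enorm_ge0.
rewrite mulrDl; apply: lerD; last first.
  by rewrite ler_peMr// -expR0 ler_expR mulr_ge0.
rewrite -mulrA ler_wpM2l// expRM_natl -exprMn lerXn2r ?nnegrE ?addr_ge0 ?enorm_ge0 ?mulr_ge0//.
apply: (@le_trans _ _ (2 * (norm1 x + norm1 y))); last by rewrite ler_wpM2l// le_expR.
have := enormD y (- x); rewrite enormN.
by have := enorm_le_norm1 x; have := enorm_le_norm1 y; have := n0 y; lra.
Qed.

Lemma tame_sample x : tamed (fun u => f (x + sigma *: u)).
Proof. exact/tame_affine/tame_SPB. Qed.

(** The part of the Lipschitz coefficient of a sample that is independent of [u]; [moment_coef]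
    multiplies [|u|^m]. The powers of 2 have integer exponents, negative when [m = 0]. *)
Definition shift_coef x y : R :=
  R2 + 2 ^ (2 * m%:Z - 2) * R1 * enorm x ^+ m + 2 ^ (m%:Z - 1) * R1 * enorm (y - x) ^+ m.

Definition moment_coef : R := 2 ^ (2 * m%:Z - 2) * R1 * sigma ^+ m.

Lemma shift_coef_ge0 x y : 0 <= shift_coef x y.
Proof.
by rewrite !addr_ge0 ?mulr_ge0 ?exprn_ge0 ?enorm_ge0 ?exprz_ge0.
Qed.

Lemma moment_coef_ge0 : 0 <= moment_coef.
Proof. by rewrite !mulr_ge0 ?exprn_ge0 ?exprz_ge0// ltW. Qed.

(** Convexity is used twice: to separate [|y - x|] from [|x + sigma u|], then [|x|] from
    [sigma |u|], with a factor [2^(m-1)] each time. *)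
Lemma sample_lipschitz x y u :
  `|f (x + sigma *: u) - f (y + sigma *: u)| <=
  (shift_coef x y + moment_coef * enorm u ^+ m) * enorm (x - y).
Proof.
apply: le_trans (SPB_lipschitz _ _ spb) _.
have sub a b : a + sigma *: u - (b + sigma *: u) = a - b.
  by rewrite opprD addrACA subrr addr0.
rewrite !sub ler_wpM2r ?enorm_ge0// /shift_coef /moment_coef.
have [_ _ R1m _ _] := spb.
(* For [m = 0] the terms with negative powers of 2 vanish because [R1 = 0]. *)
case: m R1m => [|n] R1m; first by rewrite R1m.2// !(mul0r, mulr0) !addr0 add0r.
have -> : 2 * n.+1%:Z - 2 = (n + n)%:Z by rewrite PoszD intS; ring.
have -> : n.+1%:Z - 1 = n%:Z by rewrite intS; ring.
rewrite -!exprnP.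
set c : R := 2 ^+ n; have -> : 2 ^+ (n + n) = c * c :> R by rewrite exprD.
have c0 : 0 <= c by exact: exprn_ge0.
have h1 := @exprSD_le R (enorm (x + sigma *: u)) (enorm (y - x)) n (enorm_ge0 _) (enorm_ge0 _).
have h2 : enorm (x + sigma *: u) ^+ n.+1 <=
    c * (enorm x ^+ n.+1 + sigma ^+ n.+1 * enorm u ^+ n.+1).
  rewrite -exprMn; apply: le_trans (exprSD_le _ _ _);
    rewrite ?mulr_ge0 ?enorm_ge0 ?(ltW sigma_gt0)//.
  rewrite lerXn2r ?nnegrE ?addr_ge0 ?mulr_ge0 ?enorm_ge0 ?(ltW sigma_gt0)//.
  by apply: le_trans (enormD _ _) _; rewrite enormZ gtr0_norm.
have h3 : R1 * (enorm (x + sigma *: u) + enorm (y - x)) ^+ n.+1 <=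
    R1 * (c * (c * (enorm x ^+ n.+1 + sigma ^+ n.+1 * enorm u ^+ n.+1) + enorm (y - x) ^+ n.+1)).
  rewrite ler_wpM2l//; apply: le_trans h1 _; rewrite ler_wpM2l//.
  by rewrite lerD2r.
lra.
Qed.

Let tame_bound x y :
  tamed (fun u => (shift_coef x y + moment_coef * enorm u ^+ m) * enorm (x - y)).
Proof.
apply: tameM => //; last exact: tame_cst.
apply: tameD => //; first exact: tame_cst.
by apply: tameZ => //; exact: (tameX n0 m (@tame_enorm R d)).
Qed.

Let tame_diff x y : tamed (fun u => f (x + sigma *: u) - f (y + sigma *: u)).
Proof. by apply: tameB => //; exact: tame_sample. Qed.

Lemma gsmooth_lipschitz x y : `|fs x - fs y| <=
  (moment_coef * (m + d)%:R `^ (m%:R / 2) + shift_coef x y) * enorm (x - y).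
Proof.
have tX : tamed (fun u => enorm u ^+ m) by exact: (tameX n0 m (@tame_enorm R d)).
rewrite /gsmooth -gauss_expB; [|exact: tame_sample|exact: tame_sample].
apply: le_trans (gauss_exp_norm_le (tame_diff x y) (tame_bound x y) (sample_lipschitz x y)) _.
rewrite (_ : (fun u => _) = (fun u => (moment_coef * enorm (x - y)) * enorm u ^+ m +
    shift_coef x y * enorm (x - y))); last by apply/funext => u; ring.
rewrite gauss_exp_lin//; last exact: tame_cst.
rewrite gauss_exp_cst [leRHS]mulrDl lerD2r mulrAC ler_wpM2r ?enorm_ge0//.
by rewrite ler_wpM2l ?moment_coef_ge0// gauss_exp_enormX_le.
Qed.

(** This vector turns out to be [sigma] times the gradient of the smoothed function. *)
Definition score x : 'rV[R]_d :=
  \row_i gauss_exp (fun u => u ord0 i * f (x + sigma *: u)).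

Lemma dotv_score x w :
  dotv w (score x) = gauss_exp (fun u => dotv w u * f (x + sigma *: u)).
Proof.
have tu i : tamed (fun u => u ord0 i * f (x + sigma *: u)).
  by apply: tameM => //; [exact: tame_coord|exact: tame_sample].
rewrite (_ : (fun u => _) =
    (fun u => \sum_i w ord0 i * (u ord0 i * f (x + sigma *: u)))); last first.
  by apply/funext => u; rewrite mulr_suml; apply: eq_bigr => i _; rewrite mulrA.
rewrite gauss_exp_sum; last by move=> i; exact: tameZ.
by apply: eq_bigr => i _; rewrite mxE gauss_expZ.
Qed.

(** Moving [x] by [h] shifts [u] by [h / sigma]; the second-order expansion applies when
    [|h| <= sigma]. *)
Lemma gsmooth_differentiable x :
  differentiable fs x /\ grad fs x = sigma^-1 *: score x.
Proof.
have [K K0 hK] := gauss_exp_shift_second_order (tame_sample x).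
apply: (@quadratic_error_grad _ _ _ _ _ (K * sigma^-1 ^+ 2) sigma) => //.
  by rewrite mulr_ge0// exprn_ge0// invr_ge0 ltW.
move=> h hs; have := hK (sigma^-1 *: h).
rewrite enormZ ger0_norm ?invr_ge0 ?(ltW sigma_gt0)// mulrC ler_pdivrMr// mul1r.
move=> /(_ hs); rewrite -dotv_score dotvZl.
have -> : K * sigma^-1 ^+ 2 * enorm h ^+ 2 = K * (enorm h / sigma) ^+ 2.
  by rewrite exprMn; ring.
rewrite dotvZl (dotvC _ h) /gsmooth; congr (`|_ - _ - _| <= _).
congr gauss_exp; apply/funext => u.
by rewrite scalerDr scalerA divff ?gt_eqF// scale1r addrA addrAC.
Qed.

(** The difference [w] is tested against itself: [|w.u| <= |w| |u|] under the expectation leaves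
    moments of order [m + 1] and 1, and one factor [|w|] cancels. *)
Lemma score_lipschitz x y : enorm (score x - score y) <=
  (moment_coef * (m + 1 + d)%:R `^ ((m + 1)%:R / 2) +
   shift_coef x y * Num.sqrt d%:R) * enorm (x - y).
Proof.
set w := score x - score y; set B := (X in _ <= X).
have B0 : 0 <= B.
  apply: mulr_ge0; last exact: enorm_ge0.
  apply: addr_ge0; apply: mulr_ge0; rewrite ?powR_ge0 ?sqrtr_ge0//.
    exact: moment_coef_ge0.
  exact: shift_coef_ge0.
have tX k : tamed (fun u => enorm u ^+ k) by exact: (tameX n0 k (@tame_enorm R d)).
have key : enorm w ^+ 2 <= enorm w * B.
  rewrite enorm_sqr {2}/w dotvDr dotvNr !dotv_score.
  have td z : tamed (fun u => dotv w u * f (z + sigma *: u)).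
    by apply: tameM => //; [exact: tame_dotv|exact: tame_sample].
  rewrite -gauss_expB//; apply: le_trans (ler_norm _) _.
  pose D : R := enorm w * enorm (x - y).
  apply: (@le_trans _ _ (gauss_exp (fun u => D * moment_coef * enorm u ^+ (m + 1) +
      D * shift_coef x y * enorm u ^+ 1))).
    apply: gauss_exp_norm_le; first exact: tameB.
      by apply: tameD => //; apply: tameZ.
    move=> u; rewrite -mulrBr normrM.
    apply: le_trans (ler_pM (normr_ge0 _) (normr_ge0 _) (normr_dotv_le w u)
      (sample_lipschitz x y u)) _.
    by rewrite le_eqVlt; apply/orP; left; apply/eqP; rewrite /D addn1 exprS; ring.
  rewrite gauss_exp_lin//; last exact: tameZ.
  rewrite gauss_expZ//.
  have -> : enorm w * B = D * moment_coef * (m + 1 + d)%:R `^ ((m + 1)%:R / 2) +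
      D * shift_coef x y * Num.sqrt d%:R by rewrite /B /D; ring.
  have D0 : 0 <= D by rewrite mulr_ge0 ?enorm_ge0.
  apply: lerD; apply: ler_wpM2l.
  - exact: mulr_ge0 D0 moment_coef_ge0.
  - exact: gauss_exp_enormX_le.
  - exact: mulr_ge0 D0 (shift_coef_ge0 _ _).
  - exact: gauss_exp_enorm_le.
have [->//|w0] := eqVneq (enorm w) 0.
by move: key; rewrite expr2 ler_pM2l// lt_neqAle eq_sym w0 enorm_ge0.
Qed.

End Smoothing.

Theorem theorem3p5 (R : realType) (d : nat) (f : 'rV[R]_d -> R)
    (R1 R2 : R) (m : nat) (sigma : R) :
  SPB_with f R1 R2 m -> 0 < sigma ->
  let fs := gsmooth f sigma in
  (* (i) *)
  ((forall x y : 'rV[R]_d,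
      `|fs x - fs y| <=
        ((2:R) ^ (2 * m%:Z - 2) * R1 * sigma ^+ m * ((m + d)%:R) `^ (m%:R / 2) + R2
         + (2:R) ^ (2 * m%:Z - 2) * R1 * enorm x ^+ m
         + (2:R) ^ (m%:Z - 1) * R1 * enorm (y - x) ^+ m) * enorm (x - y))
   /\ SPB fs)
  /\
  (* (ii) *)
  ((forall x : 'rV[R]_d, differentiable fs x)
   /\ (forall x y : 'rV[R]_d,
      enorm (grad fs x - grad fs y) <=
        ((2:R) ^ (2 * m%:Z - 2) * R1 * sigma ^ (m%:Z - 1)
            * ((m + 1 + d)%:R) `^ ((m + 1)%:R / 2)
          + sigma^-1 * R2 * Num.sqrt d%:R
         + (2:R) ^ (2 * m%:Z - 2) * sigma^-1 * R1 * Num.sqrt d%:R * enorm x ^+ m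
         + (2:R) ^ (m%:Z - 1) * sigma^-1 * R1 * Num.sqrt d%:R * enorm (y - x) ^+ m)
        * enorm (x - y))
   /\ (forall i : 'I_d, SPB (partial fs i))).
Proof.
move=> spb sigma0 fs.
have [R10 /ltW R20 _ _ _] := spb.
have s0 : sigma != 0 by rewrite gt_eqF.
have si0 : 0 <= sigma^-1 by rewrite invr_ge0 ltW.
have coef0 (z : int) : 0 <= (2 : R) ^ z by rewrite exprz_ge0.
have partI x y : `|fs x - fs y| <=
    (2 ^ (2 * m%:Z - 2) * R1 * sigma ^+ m * ((m + d)%:R) `^ (m%:R / 2) + R2
     + 2 ^ (2 * m%:Z - 2) * R1 * enorm x ^+ m
     + 2 ^ (m%:Z - 1) * R1 * enorm (y - x) ^+ m) * enorm (x - y).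
  by have := gsmooth_lipschitz spb sigma0 x y; rewrite /moment_coef /shift_coef !addrA.
have partII x y : enorm (grad fs x - grad fs y) <=
    (2 ^ (2 * m%:Z - 2) * R1 * sigma ^ (m%:Z - 1)
        * ((m + 1 + d)%:R) `^ ((m + 1)%:R / 2)
      + sigma^-1 * R2 * Num.sqrt d%:R
     + 2 ^ (2 * m%:Z - 2) * sigma^-1 * R1 * Num.sqrt d%:R * enorm x ^+ m
     + 2 ^ (m%:Z - 1) * sigma^-1 * R1 * Num.sqrt d%:R * enorm (y - x) ^+ m)
    * enorm (x - y).
  rewrite !(gsmooth_differentiable spb sigma0 _).2 -scalerBr enormZ ger0_norm//.
  apply: le_trans (ler_wpM2l si0 (score_lipschitz spb sigma0 x y)) _.
  (* The exponent is an integer, equal to -1 when [m = 0]; the splitting relies on [sigma != 0]. *)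
  have -> : sigma ^ (m%:Z - 1) = sigma^-1 * sigma ^+ m.
    by rewrite expfzDr// mulrC; congr (_ * _).
  rewrite /moment_coef /shift_coef le_eqVlt; apply/orP; left; apply/eqP; ring.
split; split=> //.
- apply: (SPB_of_lipschitz _ _ _ partI).
  + rewrite addr_ge0// !mulr_ge0 ?powR_ge0 ?exprn_ge0 ?(ltW sigma0)//.
  + exact: mulr_ge0.
  + exact: mulr_ge0.
- by move=> x; exact: (gsmooth_differentiable spb sigma0 x).1.
(* A coordinate of the gradient difference is at most its norm, so [partII] supplies the estimate
   and its coefficients. *)
split=> // i; apply: (@SPB_of_lipschitz _ _ _ _ _ _ m); last first.
- move=> x y; apply: le_trans (partII x y); apply: le_trans (enorm_coord _ i).
  by rewrite !mxE.
- by rewrite !mulr_ge0 ?sqrtr_ge0.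
- by rewrite !mulr_ge0 ?sqrtr_ge0.
- by rewrite addr_ge0// !mulr_ge0 ?powR_ge0 ?sqrtr_ge0 ?exprz_ge0 ?(ltW sigma0).
Qed.
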